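(* Let $p\in(0,1)$ and $p<t\le1$. Let $(h,\beta,\alpha)\in\mathbb{R}\times[0,+\infty)\times[0,1]$ with $h=h_q=\log\frac{q}{1-q}$, $q\in(0,1)$. Suppose that $$\sup_{0\le u\le1}\left[\frac\beta6u^{3\alpha}-\phi_q(u)-\frac12\log(1-q)\right]\ne\frac\beta6t^{3\alpha}-\phi_q(t)-\frac12\log(1-q),$$ where $\phi_q(u)=\inf\{\mathcal{I}_q(f):f\in\mathcal{W},\ \mathcal{T}(f)=u^3\}$; that is, the supremum is not attained at $t$. Then the importance sampling scheme (for the event $\mathcal{W}_t$ under $\mathbb{P}_{n,p}$) based on the Gibbs measure tilt $\mathbb{Q}_n^{h,\beta,\alpha}$ is not asymptotically optimal.
   Context: **Graphons.** $\mathcal{W}$ is the set of measurable symmetric functions $f:[0,1]^2\to[0,1]$, modulo identifying $f$ and $g$ when $f(x,y)=g(\sigma x,\sigma y)$ for a measure-preserving bijection $\sigma$ of $[0,1]$. For $f\in\mathcal{W}$: $\mathcal{E}(f)=\int\int f(x,y)\,dx\,dy$, $\mathcal{T}(f)=\int\int\int f(x,y)f(y,z)f(x,z)\,dx\,dy\,dz$ (integrals over $[0,1]$), and $\mathcal{W}_t=\{f\in\mathcal{W}:\mathcal{T}(f)\ge t^3\}$. **Rate function.** For $r\in(0,1)$, $I_r(u)=\frac12\left(u\log\frac ur+(1-u)\log\frac{1-u}{1-r}\right)$ for $u\in[0,1]$ (with $0\log 0=0$), and $\mathcal{I}_r(f)=\int_0^1\int_0^1I_r(f(x,y))\,dx\,dy$.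 **Graphs.** $\Omega_n=\{0,1\}^{\binom n2}$ is the set of simple graphs $X$ on $n$ vertices. $X$ is identified with the graphon equal to $X_{ij}$ on $[\frac{i-1}n,\frac in)\times[\frac{j-1}n,\frac jn)$ ($X_{ji}=X_{ij}$, $X_{ii}=0$), so $\mathcal{E}(X)=\frac2{n^2}\#\{\text{edges}\}$ and $\mathcal{T}(X)=\frac6{n^3}\#\{\text{triangles}\}$. $\mathbb{P}_{n,p}$ is the law of the Erdős–Rényi graph $\mathcal{G}_{n,p}$ (independent edges with probability $p$). **Gibbs tilt.** $\mathbb{Q}_n^{h,\beta,\alpha}$ is the probability measure on $\Omega_n$ with $\mathbb{Q}_n^{h,\beta,\alpha}(X)\propto\exp\left(n^2\left(\frac h2\mathcal{E}(X)+\frac\beta6\mathcal{T}(X)^\alpha\right)\right)$ (convention $0^0=1$ if $\alpha=0$). **Asymptotic optimality.** Importance sampling based on $\mathbb{Q}_n$ estimates $\mathbb{P}_{n,p}(\mathcal{W}_t)$ by averaging $\mathbf{1}_{\mathcal{W}_t}(\tilde X)\frac{d\mathbb{P}_{n,p}}{d\mathbb{Q}_n}(\tilde X)$ over i.i.d. samples $\tilde X\sim\mathbb{Q}_n$. The scheme based on $\mathbb{Q}_n$ is asymptotically optimal if $$\lim_{n\to\infty}\frac1{n^2}\log\mathbb{E}_{\mathbb{Q}_n}\left[\left(\mathbf{1}_{\mathcal{W}_t}\frac{d\mathbb{P}_{n,p}}{d\mathbb{Q}_n}\right)^2\right]=-2\inf_{f\in\mathcal{W}_t}\mathcal{I}_p(f)$$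 (with $\log0=-\infty$). *)

(* Defs.v *)
From HB Require Import structures.
From mathcomp Require Import all_boot all_order all_algebra.
From mathcomp Require Import all_classical all_reals all_analysis.

Set Implicit Arguments.
Unset Strict Implicit.
Unset Printing Implicit Defensive.

Import Order.TTheory GRing.Theory Num.Theory.
Import numFieldNormedType.Exports.

Local Open Scope classical_set_scope.
Local Open Scope ring_scope.

Section Graphons.
Context {R : realType}.
Implicit Types (f : R -> R -> R) (r t u x y : R).

Local Notation mu := (@lebesgue_measure R).
Local Notation I01 := (`[0, 1]%classic : set R).

(* Graphons are handled through representatives: [edge_density],
   [triangle_density] and [entropy] are invariant under the measure-preserving
   relabellings by which graphons are usually identified, so the infima below
   are the same over representatives as over classes.  Values outside of the
   unit square are irrelevant. *)
Definition graphons : set (R -> R -> R) := [set f : R -> R -> R |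
  [/\ measurable_fun (I01 `*` I01) (fun z : R * R => f z.1 z.2),
      {in I01 &, forall x y, f x y = f y x} &
      {in I01 &, forall x y, 0 <= f x y <= 1}]].

Definition edge_density f : R :=
  \int[mu]_(x in I01) \int[mu]_(y in I01) f x y.

Definition triangle_density f : R :=
  \int[mu]_(x in I01) \int[mu]_(y in I01) \int[mu]_(z in I01)
    (f x y * f y z * f x z).

Definition triangle_upper t : set (R -> R -> R) :=
  [set f | graphons f /\ t ^+ 3 <= triangle_density f].

(* The convention 0 log 0 = 0 holds since [ln 0 = 0]. *)
Definition entropy_fun r u : R :=
  2^-1 * (u * ln (u / r) + (1 - u) * ln ((1 - u) / (1 - r))).

Definition entropy r f : R :=
  \int[mu]_(x in I01) \int[mu]_(y in I01) entropy_fun r (f x y).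

Definition phi r u : R :=
  inf [set entropy r f | f in [set f : R -> R -> R | graphons f /\ triangle_density f = u ^+ 3]].

End Graphons.

(* One bit for each pair of vertices i < j. *)
Definition edge_slot (n : nat) := {e : 'I_n * 'I_n | (e.1 < e.2)%N}.

Definition Omega (n : nat) := {ffun edge_slot n -> bool}.

Definition adj (n : nat) (X : Omega n) (i j : 'I_n) : bool :=
  oapp X false (insub (i, j)) || oapp X false (insub (j, i)).

Section RandomGraphs.
Context {R : realType}.

(* Vertices are numbered from 0, so that vertex i owns [i/n, (i+1)/n). *)
Definition graphon_of (n : nat) (X : Omega n) (x y : R) : R :=
  \sum_(i < n) \sum_(j < n) (adj X i j)%:R
    * \1_(`[i%:R / n%:R, i.+1%:R / n%:R[%classic) x
    * \1_(`[j%:R / n%:R, j.+1%:R / n%:R[%classic) y.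

(* Probability measures on the finite set [Omega n] are given by their mass
   functions. *)
Definition expectation_pmf (n : nat) (Q g : Omega n -> R) : R :=
  \sum_(X : Omega n) Q X * g X.

Definition erdos_renyi (p : R) (n : nat) (X : Omega n) : R :=
  \prod_(e : edge_slot n) (if X e then p else 1 - p).

(* Note that [0 `^ 0 = 1] for [powR]. *)
Definition gibbs_weight (h beta alpha : R) (n : nat) (X : Omega n) : R :=
  expR (n%:R ^+ 2 * (h / 2 * edge_density (graphon_of X)
                     + beta / 6 * triangle_density (graphon_of X) `^ alpha)).

Definition gibbs (h beta alpha : R) (n : nat) (X : Omega n) : R :=
  gibbs_weight h beta alpha X / \sum_(Y : Omega n) gibbs_weight h beta alpha Y.

Definition second_moment (p t : R) (n : nat) (Q : Omega n -> R) : R :=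
  expectation_pmf Q (fun X =>
    (\1_(triangle_upper t) (graphon_of X) * (erdos_renyi p X / Q X)) ^+ 2).

(* The extended logarithm [lne] satisfies [lne 0 = -oo], so the sequence below
   lives in the extended reals. *)
Definition asymptotically_optimal (p t : R)
    (Q : forall n : nat, Omega n -> R) : Prop :=
  ((n%:R ^- 2)%:E * lne (second_moment p t (@Q n))%:E)%E @[n --> \oo]
    --> (- 2 * inf [set entropy p f | f in triangle_upper t])%:E.

End RandomGraphs.

(* Main.v *)
Require Import Defs.
From HB Require Import structures.
From mathcomp Require Import all_boot all_order all_algebra.
From mathcomp Require Import all_classical all_reals all_analysis.
From mathcomp Require Import measurable_realfun.
From mathcomp Require Import ring lra zify.

Set Implicit Arguments.
Unset Strict Implicit.
Unset Printing Implicit Defensive.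

Import Order.TTheory GRing.Theory Num.Theory.
Import numFieldNormedType.Exports.

Local Open Scope classical_set_scope.
Local Open Scope ring_scope.

(** The second moment factors as [Z_n] times the sum over the graphs [X] with at
    least the prescribed number of triangles of [P(X) ^ 2 / w(X)], where [w] is the
    unnormalized weight of the tilt and [Z_n] its partition function.  Both factors
    are bounded below on the scale [exp (n^2 c)] by the graphs close to one
    well-chosen kernel.

    Let [I_r f] be [entropy r f] and [J] the infimum of [I_p] above the threshold.
    Let [f] be a near-minimizer for [J], with triangle density [t ^ 3].  The graphs
    close to [f] contribute to the sum the exponential rate
      [- 2 I_p f + I_q f + ln (1 - q) / 2 - beta / 6 * t ^ (3 alpha)],
    and [I_q f >= phi q t].  The graphs close to a kernel [g] of triangle density
    [u ^ 3] with [I_q g] close to [phi q u] contribute to [Z_n] the rate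
      [beta / 6 * u ^ (3 alpha) - phi q u - ln (1 - q) / 2].
    If the supremum is not attained at [t], some [u] gives a strictly larger value
    than [t], and then the two rates add up to strictly more than [- 2 J].

    Everything therefore rests on [count_kernel]: there are at least
    [exp (- n^2 (neg_entropy f + o(1)))] graphs on [n] vertices whose edge and
    triangle densities are close to those of [f].  For a step kernel, draw the
    edges independently with the probabilities prescribed by the kernel
    ([typical_graphs]): the two densities and the log-likelihood have small
    variance, and a set of probability one half, each of whose elements has
    probability about [exp (n^2 neg_entropy f)], is large ([count_step]).  Step
    kernels are dense in L^1 ([step_approximable_bmeas], [kernel_step_approx]), and
    the three functionals are continuous there.

    Two perturbations make the kernels usable.  A near-minimizer is first moved to
    the threshold by mixing it with the constant [p] ([entropy_at_threshold]), so
    that the definition of [phi q t] applies to it, and then pushed slightly above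
    the threshold by mixing it with the constant [1] ([raise_triangles]), so that
    the graphs close to it satisfy the constraint.  The latter is impossible for
    [t = 1], where the second moment vanishes ([not_optimal_threshold_one]). *)

(** * Averages over the unit interval *)

Section Averaging.
Context {R : realType}.
Local Notation mu := (@lebesgue_measure R).
Local Notation I01 := (`[0, 1]%classic : set R).

Definition avg (F : R -> R) : R := \int[mu]_(x in I01) F x.

Definition bmeas (d : measure_display) (A : measurableType d) (F : A -> R) : Prop :=
  measurable_fun setT F /\ exists M, forall x, `|F x| <= M.

Lemma bmeas_cst (d : measure_display) (A : measurableType d) (c : R) : bmeas (fun _ : A => c).
Proof. by split; [exact: measurable_cst|exists `|c|]. Qed.

Lemma bmeasD (d : measure_display) (A : measurableType d) (F G : A -> R) :
  bmeas F -> bmeas G -> bmeas (fun x => F x + G x).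
Proof.
move=> [mF [M FM]] [mG [N GN]]; split; first exact: measurable_funD.
by exists (M + N) => x; rewrite (le_trans (ler_normD _ _))// lerD.
Qed.

Lemma bmeasM (d : measure_display) (A : measurableType d) (F G : A -> R) :
  bmeas F -> bmeas G -> bmeas (fun x => F x * G x).
Proof.
move=> [mF [M FM]] [mG [N GN]]; split; first exact: measurable_funM.
by exists (M * N) => x; rewrite normrM ler_pM.
Qed.

Lemma bmeasZ (d : measure_display) (A : measurableType d) (c : R) (F : A -> R) :
  bmeas F -> bmeas (fun x => c * F x).
Proof. exact/bmeasM/bmeas_cst. Qed.

Lemma bmeasB (d : measure_display) (A : measurableType d) (F G : A -> R) :
  bmeas F -> bmeas G -> bmeas (fun x => F x - G x).
Proof.
move=> bF bG; have := bmeasD bF (bmeasZ (-1) bG).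
by under eq_fun do rewrite mulN1r.
Qed.

Lemma bmeas_norm (d : measure_display) (A : measurableType d) (F : A -> R) :
  bmeas F -> bmeas (fun x => `|F x|).
Proof.
move=> [mF [M FM]]; split; first exact: measurableT_comp.
by exists M => x; rewrite normr_id.
Qed.

Lemma bmeas_sum (d : measure_display) (A : measurableType d) (J : Type) (r : seq J)
    (F : J -> A -> R) :
  (forall j, bmeas (F j)) -> bmeas (fun x => \sum_(j <- r) F j x).
Proof.
move=> bF; elim: r => [|j r IH].
  by under eq_fun do rewrite big_nil; exact: bmeas_cst.
by under eq_fun do rewrite big_cons; exact: bmeasD.
Qed.

Lemma bmeas_comp (d d' : measure_display) (A : measurableType d) (B : measurableType d')
    (F : A -> R) (u : B -> A) :
  bmeas F -> measurable_fun setT u -> bmeas (fun x => F (u x)).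
Proof.
by move=> [mF [M FM]] mu'; split; [exact: measurableT_comp mF mu'|exists M].
Qed.

Lemma integrable_bmeas (F : R -> R) : bmeas F -> mu.-integrable I01 (EFin \o F).
Proof.
move=> [mF [M FM]]; apply: measurable_bounded_integrable => //.
- by rewrite /= lebesgue_measure_itv/= lte01 oppr0 adde0 ltry.
- exact: measurable_funTS.
- exists M; split; first exact: num_real.
  by move=> N MN x _; exact: le_trans (FM x) (ltW MN).
Qed.

Lemma avg_cst c : avg (fun=> c) = c.
Proof. by rewrite /avg Rintegral_cst//= lebesgue_measure_itv/= lte01 oppr0 adde0 mulr1. Qed.

Lemma avgD F G : bmeas F -> bmeas G -> avg (fun x => F x + G x) = avg F + avg G.
Proof. by move=> bF bG; rewrite /avg RintegralD//; exact: integrable_bmeas. Qed.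

Lemma avgZ c F : bmeas F -> avg (fun x => c * F x) = c * avg F.
Proof. by move=> bF; rewrite /avg RintegralZl//; exact: integrable_bmeas. Qed.

Lemma avgB F G : bmeas F -> bmeas G -> avg (fun x => F x - G x) = avg F - avg G.
Proof. by move=> bF bG; rewrite /avg RintegralB//; exact: integrable_bmeas. Qed.

Lemma avg_sum (J : Type) (r : seq J) (F : J -> R -> R) :
  (forall j, bmeas (F j)) ->
  avg (fun x => \sum_(j <- r) F j x) = \sum_(j <- r) avg (F j).
Proof.
move=> bF; elim: r => [|j r IH].
  by under eq_fun do rewrite big_nil; rewrite avg_cst big_nil.
under eq_fun do rewrite big_cons.
by rewrite avgD ?IH ?big_cons//; exact: bmeas_sum.
Qed.

Lemma eq_avg F G : {in I01, F =1 G} -> avg F = avg G.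
Proof. by move=> FG; apply: eq_Rintegral. Qed.

Lemma le_avg F G : bmeas F -> bmeas G -> (forall x, I01 x -> F x <= G x) -> avg F <= avg G.
Proof. by move=> bF bG FG; apply: le_Rintegral => //; exact: integrable_bmeas. Qed.

Lemma le_norm_avg F : bmeas F -> `|avg F| <= avg (fun x => `|F x|).
Proof. by move=> bF; apply: le_normr_Rintegral => //; exact: integrable_bmeas. Qed.

Lemma avg_bound F M : bmeas F -> (forall x, I01 x -> `|F x| <= M) -> `|avg F| <= M.
Proof.
move=> bF FM; rewrite (le_trans (le_norm_avg bF))// -[leRHS]avg_cst.
by apply: le_avg => //; [exact: bmeas_norm|exact: bmeas_cst].
Qed.

(** Nonnegative functions have measurable partial integrals; adding a bound
    for [F] makes it nonnegative. *)
Lemma bmeas_avg (d : measure_display) (A : measurableType d) (F : A * R -> R) :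
  bmeas F -> bmeas (fun a => avg (fun y => F (a, y))).
Proof.
move=> bF; have [mF [M FM]] := bF.
have bFa a : bmeas (fun y => F (a, y)).
  by apply: bmeas_comp bF _; exact: measurable_fun_pair.
split; last by exists M => a; apply: avg_bound.
pose G (z : A * R) : R := (F z + M) * \1_I01 z.2.
have mG : measurable_fun setT G.
  apply: measurable_funM; first exact: measurable_funD.
  by apply: measurableT_comp => //; exact: measurable_indic.
have G0 z : (0 <= (G z)%:E)%E.
  rewrite lee_fin mulr_ge0 ?indicE//.
  by have := FM z; rewrite ler_norml -[- M <= _]subr_ge0 opprK => /andP[].
have := measurable_fun_fubini_tonelli_F (m2 := mu) (fun z => (G z)%:E)
  (iffRL (measurable_EFinP _ _) mG) G0.
rewrite /fubini_F => mI.
have -> : (fun a => avg (fun y => F (a, y))) =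
    (fun a => fine (\int[mu]_y (G (a, y))%:E)%E - M).
  apply/funext => a.
  have -> : (\int[mu]_y (G (a, y))%:E)%E = (\int[mu]_(y in I01) (F (a, y) + M)%:E)%E.
    rewrite [RHS]integral_mkcond; apply: eq_integral => y _.
    by rewrite /G/= patchE indicE; case: ifP; rewrite ?mulr1// mulr0.
  apply/eqP; rewrite eq_sym subr_eq -[X in _ + X]avg_cst -avgD//.
  exact: bmeas_cst.
apply: measurable_funB => //.
exact: (measurableT_comp (@fine_measurable _ _ measurableT)).
Qed.

Lemma cvg_avg (F : nat -> R -> R) (G : R -> R) (M : R) :
  (forall n, bmeas (F n)) -> bmeas G ->
  (forall n x, I01 x -> `|F n x| <= M) ->
  (forall x, I01 x -> F ^~ x @ \oo --> G x) ->
  avg (F n) @[n --> \oo] --> avg G.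
Proof.
move=> bF bG FM FG; rewrite /avg /Rintegral; apply: fine_cvg.
rewrite fineK; last exact: (integrable_fin_num _ (integrable_bmeas bG)).
have [] := @dominated_convergence _ _ R mu I01 (measurable_itv _)
  (fun n x => (F n x)%:E) (fun x => (G x)%:E) (cst M%:E); last by move=> _ _; apply.
- by move=> n; apply/measurable_EFinP/measurable_funTS; case: (bF n).
- by apply/measurable_EFinP/measurable_funTS; case: bG.
- by apply: aeW => x xI; apply: cvg_EFin; [exact: nearW|exact: FG].
- by apply: (@integrable_bmeas (fun=> M)); exact: bmeas_cst.
- by apply: aeW => x n xI; rewrite /= lee_fin; exact: FM.
Qed.

End Averaging.

(** * Iterated averages and finite labellings of the unit interval *)

Section IteratedAverages.
Context {R : realType}.
Local Notation I01 := (`[0, 1]%classic : set R).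
Implicit Types F G : R -> R -> R.

Definition avg2 F : R := avg (fun x => avg (F x)).

Definition bmeas2 F : Prop := bmeas (fun z : R * R => F z.1 z.2).

Lemma bmeas2_row F x : bmeas2 F -> bmeas (F x).
Proof.
move=> bF; apply: (@bmeas_comp _ _ _ _ _ (fun z : R * R => F z.1 z.2) (pair x)) => //.
Qed.

Lemma bmeas2_avg F : bmeas2 F -> bmeas (fun x => avg (F x)).
Proof. by move=> bF; have := bmeas_avg bF. Qed.

Lemma bmeas2_cst c : bmeas2 (fun _ _ => c).
Proof. exact: bmeas_cst. Qed.

Lemma bmeas2D F G : bmeas2 F -> bmeas2 G -> bmeas2 (fun x y => F x y + G x y).
Proof. exact: bmeasD. Qed.

Lemma bmeas2B F G : bmeas2 F -> bmeas2 G -> bmeas2 (fun x y => F x y - G x y).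
Proof. exact: bmeasB. Qed.

Lemma bmeas2Z c F : bmeas2 F -> bmeas2 (fun x y => c * F x y).
Proof. exact: bmeasZ. Qed.

Lemma bmeas2_norm F : bmeas2 F -> bmeas2 (fun x y => `|F x y|).
Proof. exact: bmeas_norm. Qed.

Lemma bmeas2_sum (J : Type) (r : seq J) (F : J -> R -> R -> R) :
  (forall j, bmeas2 (F j)) -> bmeas2 (fun x y => \sum_(j <- r) F j x y).
Proof. by move=> bF; apply: (bmeas_sum r bF). Qed.

Lemma avg2_cst c : avg2 (fun _ _ => c) = c.
Proof. by rewrite /avg2; under eq_fun do rewrite avg_cst; rewrite avg_cst. Qed.

Lemma avg2D F G : bmeas2 F -> bmeas2 G ->
  avg2 (fun x y => F x y + G x y) = avg2 F + avg2 G.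
Proof.
move=> bF bG; rewrite /avg2 -avgD; [|exact: bmeas2_avg..].
by congr avg; apply/funext => x; rewrite avgD//; exact: bmeas2_row.
Qed.

Lemma avg2B F G : bmeas2 F -> bmeas2 G ->
  avg2 (fun x y => F x y - G x y) = avg2 F - avg2 G.
Proof.
move=> bF bG; rewrite /avg2 -avgB; [|exact: bmeas2_avg..].
by congr avg; apply/funext => x; rewrite avgB//; exact: bmeas2_row.
Qed.

Lemma avg2Z c F : bmeas2 F -> avg2 (fun x y => c * F x y) = c * avg2 F.
Proof.
move=> bF; rewrite /avg2 -avgZ; last exact: bmeas2_avg.
by congr avg; apply/funext => x; rewrite avgZ//; exact: bmeas2_row.
Qed.

Lemma eq_avg2 F G : (forall x y, I01 x -> I01 y -> F x y = G x y) -> avg2 F = avg2 G.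
Proof.
move=> FG; apply: eq_avg => x /set_mem xI; apply: eq_avg => y /set_mem yI.
exact: FG.
Qed.

Lemma le_avg2 F G : bmeas2 F -> bmeas2 G ->
  (forall x y, I01 x -> I01 y -> F x y <= G x y) -> avg2 F <= avg2 G.
Proof.
move=> bF bG FG; apply: le_avg => [||x xI]; [exact: bmeas2_avg..|].
by apply: le_avg => [||y yI]; [exact: bmeas2_row..|exact: FG].
Qed.

Lemma bmeas2_dist F G : bmeas2 F -> bmeas2 G -> bmeas2 (fun x y => `|F x y - G x y|).
Proof. by move=> bF bG; apply: bmeas2_norm; exact: bmeas2B. Qed.

Lemma le_norm_avg2 F : bmeas2 F -> `|avg2 F| <= avg2 (fun x y => `|F x y|).
Proof.
move=> bF; rewrite (le_trans (le_norm_avg _))//; first exact: bmeas2_avg.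
apply: le_avg => [||x xI].
- exact/bmeas_norm/bmeas2_avg.
- exact/bmeas2_avg/bmeas2_norm.
- exact/le_norm_avg/bmeas2_row.
Qed.

Lemma avg2_dist_trans F G H : bmeas2 F -> bmeas2 G -> bmeas2 H ->
  avg2 (fun x y => `|F x y - H x y|) <=
  avg2 (fun x y => `|F x y - G x y|) + avg2 (fun x y => `|G x y - H x y|).
Proof.
move=> bF bG bH; rewrite -avg2D; [|exact: bmeas2_dist..].
apply: le_avg2 => [||x y _ _]; first exact: bmeas2_dist.
  by apply: bmeas2D; exact: bmeas2_dist.
exact: ler_distD.
Qed.

Lemma cvg_avg2 (F : nat -> R -> R -> R) G (M : R) :
  (forall n, bmeas2 (F n)) -> bmeas2 G ->
  (forall n x y, `|F n x y| <= M) ->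
  (forall x y, F n x y @[n --> \oo] --> G x y) ->
  avg2 (F n) @[n --> \oo] --> avg2 G.
Proof.
move=> bF bG FM FG; apply: (@cvg_avg _ _ _ M) => [n||n x xI|x xI].
- exact: bmeas2_avg.
- exact: bmeas2_avg.
- by apply: avg_bound => //; exact: bmeas2_row.
- by apply: (@cvg_avg _ _ _ M) => // [n|]; exact: bmeas2_row.
Qed.

End IteratedAverages.

Section Labels.
Context {R : realType}.

(** A measurable labelling by a finite type plays the role of a finite measurable
    partition.  Labels make common refinements trivial: they are pairs. *)
Definition measurable_label (d : measure_display) (A : measurableType d) (L : finType) (s : A -> L) : Prop :=
  forall k, measurable (s @^-1` [set k]).

Lemma measurable_label_comp (d d' : measure_display) (A : measurableType d) (B : measurableType d')
    (L : finType) (s : A -> L) (u : B -> A) :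
  measurable_label s -> measurable_fun setT u -> measurable_label (fun x => s (u x)).
Proof.
move=> ls mu k; rewrite -[X in measurable X]setTI.
exact: (mu measurableT _ (ls k)).
Qed.

Lemma measurable_label_pair (d : measure_display) (A : measurableType d)
    (L L' : finType) (s : A -> L) (s' : A -> L') :
  measurable_label s -> measurable_label s' -> measurable_label (fun x => (s x, s' x)).
Proof.
move=> ls ls' [k k'].
rewrite (_ : _ @^-1` _ = s @^-1` [set k] `&` s' @^-1` [set k']); first exact: measurableI.
by apply/seteqP; split=> x /= [-> ->].
Qed.

Lemma measurable_label_mem (d : measure_display) (A : measurableType d) (B : set A) :
  measurable B -> measurable_label (fun x => x \in B).
Proof.
move=> mB [].
  rewrite (_ : _ @^-1` _ = B)//.
  by apply/seteqP; split=> x /=; [exact: set_mem|exact: mem_set].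
rewrite (_ : _ @^-1` _ = ~` B); first exact: measurableC.
by apply/seteqP; split=> x /=; [move=> xB Bx; rewrite mem_set in xB|exact: memNset].
Qed.

Lemma sum_indic_label (A : Type) (L : finType) (s : A -> L) (g : L -> R) x :
  g (s x) = \sum_(k : L) g k * \1_(s @^-1` [set k]) x.
Proof.
rewrite (bigD1 (s x))//= big1 ?addr0 => [|k kx].
  by rewrite indicE mem_set// mulr1.
by rewrite indicE memNset ?mulr0// => /= sx; rewrite sx eqxx in kx.
Qed.

Lemma bmeas_indic (d : measure_display) (A : measurableType d) (B : set A) :
  measurable B -> bmeas (\1_B : A -> R).
Proof.
move=> mB; split; first exact: measurable_indic.
by exists 1 => x; rewrite indicE ger0_norm//; case: (_ \in _).
Qed.

Lemma bmeas_label (d : measure_display) (A : measurableType d) (L : finType) (s : A -> L) (g : L -> R) :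
  measurable_label s -> bmeas (fun x => g (s x)).
Proof.
move=> ls; under eq_fun do rewrite sum_indic_label.
apply: bmeas_sum => k; apply: bmeasZ; exact: bmeas_indic.
Qed.

Definition freq (L : finType) (s : R -> L) (k : L) : R := avg (\1_(s @^-1` [set k])).

Lemma avg_label (L : finType) (s : R -> L) (g : L -> R) :
  measurable_label s -> avg (fun x => g (s x)) = \sum_k freq s k * g k.
Proof.
move=> ls; under eq_fun do rewrite sum_indic_label.
rewrite avg_sum => [|k]; last by apply: bmeasZ; exact: bmeas_indic.
apply: eq_bigr => k _; rewrite [RHS]mulrC; apply: avgZ; exact: bmeas_indic.
Qed.

Lemma freq_ge0 (L : finType) (s : R -> L) k : 0 <= freq s k.
Proof. by apply: Rintegral_ge0 => x _; rewrite indicE. Qed.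

Lemma freq_sum1 (L : finType) (s : R -> L) : measurable_label s -> \sum_k freq s k = 1.
Proof.
move=> ls; rewrite -[RHS](avg_cst (1 : R)) (avg_label (fun=> 1) ls).
by apply: eq_bigr => k _; rewrite mulr1.
Qed.

Lemma bmeas2_label (L : finType) (s : R -> L) (a : L -> L -> R) :
  measurable_label s -> bmeas2 (fun x y => a (s x) (s y)).
Proof.
move=> ls; apply: (@bmeas_label _ _ _ (fun z : R * R => (s z.1, s z.2)) (fun k => a k.1 k.2)).
by apply: measurable_label_pair; apply: measurable_label_comp ls _.
Qed.

Lemma avg2_label (L : finType) (s : R -> L) (a : L -> L -> R) : measurable_label s ->
  avg2 (fun x y => a (s x) (s y)) = \sum_k freq s k * \sum_l freq s l * a k l.
Proof.
move=> ls; rewrite /avg2.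
rewrite -(avg_label (fun k => \sum_l freq s l * a k l) ls).
by congr avg; apply/funext => x; exact: avg_label.
Qed.

End Labels.

(** * Density of step kernels in the L^1 distance *)

Section StepDensity.
Context {R : realType}.
Implicit Types F G : R -> R -> R.

(** Steps are allowed to be arbitrary measurable sets instead of intervals, so
    that rectangles are step kernels themselves. *)
Definition step_approximable F : Prop := forall e : R, 0 < e ->
  exists (L : finType) (s : R -> L) (a : L -> L -> R),
    measurable_label s /\ avg2 (fun x y => `|F x y - a (s x) (s y)|) <= e.

Lemma step_approximable_label (L : finType) (s : R -> L) (a : L -> L -> R) :
  measurable_label s -> step_approximable (fun x y => a (s x) (s y)).
Proof.
move=> ls e e0; exists L, s, a; split=> //.
rewrite (_ : (fun x y => _) = fun _ _ => 0) ?avg2_cst ?ltW//.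
by apply/funext => x; apply/funext => y; rewrite subrr normr0.
Qed.

Lemma step_approximable_cst c : step_approximable (fun _ _ => c).
Proof.
apply: (@step_approximable_label _ (fun=> tt) (fun _ _ => c)) => -[].
by rewrite (_ : _ @^-1` _ = setT)//; apply/seteqP; split.
Qed.

Lemma step_approximableD F G : bmeas2 F -> bmeas2 G -> step_approximable F -> step_approximable G ->
  step_approximable (fun x y => F x y + G x y).
Proof.
move=> bF bG sF sG e e0; have e20 : 0 < e / 2 by rewrite divr_gt0.
have [L [s [a [ls sa]]]] := sF _ e20; have [L' [s' [a' [ls' sa']]]] := sG _ e20.
exists (L * L')%type, (fun x => (s x, s' x)), (fun k l => a k.1 l.1 + a' k.2 l.2).
split; first exact: measurable_label_pair.
rewrite (splitr e) (le_trans _ (lerD sa sa'))//.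
have bs : bmeas2 (fun x y => a (s x) (s y)) by exact: bmeas2_label.
have bs' : bmeas2 (fun x y => a' (s' x) (s' y)) by exact: bmeas2_label.
rewrite -avg2D; [|exact: bmeas2_dist..].
apply: le_avg2 => [||x y _ _ /=].
- by apply: (bmeas2_dist (bmeas2D bF bG) (bmeas2D bs bs')).
- by apply: bmeas2D; exact: bmeas2_dist.
- by rewrite opprD addrACA; exact: ler_normD.
Qed.

Lemma step_approximableZ c F : bmeas2 F -> step_approximable F -> step_approximable (fun x y => c * F x y).
Proof.
move=> bF sF e e0; have c0 : 0 < `|c| + 1 by rewrite ltr_wpDl.
have [L [s [a [ls sa]]]] := sF _ (divr_gt0 e0 c0).
have bs : bmeas2 (fun x y => a (s x) (s y)) by exact: bmeas2_label.
have Ec : (fun x y => `|c * F x y - c * a (s x) (s y)|) =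
          (fun x y => `|c| * `|F x y - a (s x) (s y)|).
  by apply/funext => x; apply/funext => y; rewrite -mulrBr normrM.
exists L, s, (fun k l => c * a k l); split=> //.
rewrite Ec avg2Z; last exact: bmeas2_dist.
rewrite (le_trans (ler_wpM2l _ sa))// mulrC -mulrA ler_piMr ?(ltW e0)//.
by rewrite ler_pdivrMl// mulr1 lerDl.
Qed.

Lemma step_approximable_sum (J : Type) (r : seq J) (F : J -> R -> R -> R) :
  (forall j, bmeas2 (F j)) -> (forall j, step_approximable (F j)) ->
  step_approximable (fun x y => \sum_(j <- r) F j x y).
Proof.
move=> bF sF; elim: r => [|j r IH].
  have -> : (fun x y : R => \sum_(j <- [::]) F j x y) = fun _ _ => 0.
    by apply/funext => x; apply/funext => y; rewrite big_nil.
  exact: step_approximable_cst.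
have -> : (fun x y : R => \sum_(i <- j :: r) F i x y) =
    fun x y => F j x y + \sum_(i <- r) F i x y.
  by apply/funext => x; apply/funext => y; rewrite big_cons.
by apply: step_approximableD; [exact: bF|exact: bmeas2_sum|exact: sF|exact: IH].
Qed.

Lemma step_approximable_limit F : bmeas2 F ->
  (forall e : R, 0 < e -> exists G, [/\ bmeas2 G, step_approximable G &
     avg2 (fun x y => `|F x y - G x y|) <= e]) -> step_approximable F.
Proof.
move=> bF FG e e0; have e20 : 0 < e / 2 by rewrite divr_gt0.
have [G [bG sG FGe]] := FG _ e20; have [L [s [a [ls sa]]]] := sG _ e20.
exists L, s, a; split=> //.
have bs : bmeas2 (fun x y => a (s x) (s y)) by exact: bmeas2_label.
by apply: le_trans (avg2_dist_trans bF bG bs) _; rewrite [leRHS]splitr; exact: lerD FGe sa.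
Qed.

Definition ind2 (B : set (R * R)) (x y : R) : R := \1_B (x, y).

Lemma bmeas2_ind2 B : measurable B -> bmeas2 (ind2 B).
Proof.
move=> mB; rewrite /bmeas2 /ind2; under eq_fun do rewrite -surjective_pairing.
exact: bmeas_indic.
Qed.

Lemma sum_indic_trivIset (T : Type) (F : (set T)^nat) n i z :
  trivIset setT F -> F i z -> \sum_(j < n) \1_(F j) z = (i < n)%:R :> R.
Proof.
move=> tF Fiz; elim: n => [|n IH]; first by rewrite big_ord0.
rewrite big_ord_recr/= IH indicE.
have [->|ni] := eqVneq n i; first by rewrite ltnn ltnSn mem_set// add0r.
rewrite memNset ?addr0; first by rewrite ltnS [in RHS]leq_eqVlt [(i == n)%N]eq_sym (negbTE ni).
move=> Fnz; move/eqP: ni; apply.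
by apply: (tF n i) => //; exists z.
Qed.

Lemma sum_ltn n m : \sum_(j < n) (j < m)%:R = (minn n m)%:R :> R.
Proof.
elim: n => [|n IH]; first by rewrite big_ord0 min0n.
rewrite big_ord_recr/= IH -natrD; congr _%:R; case: ltnP => nm /=; rewrite ?addn0 ?addn1; lia.
Qed.

(** The partial unions converge by dominated convergence, and each of them is a
    finite sum of indicators because the sets are disjoint. *)
Lemma step_approximable_bigcup (F : (set (R * R))^nat) :
  (forall n, measurable (F n)) -> trivIset setT F ->
  (forall n, step_approximable (ind2 (F n))) -> step_approximable (ind2 (\bigcup_k F k)).
Proof.
move=> mF tF sF.
have bU : bmeas2 (ind2 (\bigcup_k F k)) by exact/bmeas2_ind2/bigcup_measurable.
pose S n x y := \sum_(j < n) ind2 (F j) x y.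
have bS n : bmeas2 (S n) by apply: bmeas2_sum => j; exact: bmeas2_ind2.
apply: step_approximable_limit => // e e0.
have D x y : exists i, forall n, `|ind2 (\bigcup_k F k) x y - S n x y| = (n <= i)%:R
    \/ `|ind2 (\bigcup_k F k) x y - S n x y| = 0.
  have [[i _ Fi]|nF] := pselect ((\bigcup_k F k) (x, y)).
    exists i => m; left; rewrite /S (sum_indic_trivIset _ tF Fi) /ind2 indicE.
    rewrite mem_set; last by exists i.
    by case: ltnP; rewrite /= ?subrr ?normr0 ?subr0 ?normr1.
  exists 0%N => m; right; rewrite /ind2 indicE memNset// /S big1 ?subrr ?normr0// => j _.
  by rewrite /ind2 indicE memNset// => Fj; apply: nF; exists j.
have : avg2 (fun x y => `|ind2 (\bigcup_k F k) x y - S n x y|) @[n --> \oo]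
    --> avg2 (fun _ _ => 0 : R).
  apply: (@cvg_avg2 _ _ _ 1) => [n||n x y|x y].
  - exact: bmeas2_dist.
  - exact: bmeas2_cst.
  - rewrite normr_id; have [i /(_ n)[|] ->//] := D x y.
    by case: (_ <= _)%N.
  - have [i Hi] := D x y; apply/cvgrPdist_le => d d0; near=> n.
    rewrite sub0r normrN normr_id; have [|] := Hi n => ->; last exact: ltW.
    rewrite leqNgt (_ : (i < n)%N) ?ltW//.
    by near: n; exact: nbhs_infty_gt.
rewrite avg2_cst => /cvgrPdist_le /(_ _ e0)[N _ /(_ N (leqnn _))] /= SN.
exists (S N); split => //; first by apply: step_approximable_sum => // j; exact: bmeas2_ind2.
by apply: le_trans SN; rewrite sub0r normrN ler_norm.
Unshelve. all: by end_near. Qed.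

(** Rectangles form a generating pi-system, and the approximable sets form a
    Dynkin system. *)
Lemma step_approximable_ind2 B : measurable B -> step_approximable (ind2 B).
Proof.
move=> mB; have gB : <<s [set A1 `*` A2 | A1 in measurable & A2 in measurable] >> B.
  by rewrite -measurable_prod_measurableType.
apply: (@dynkin_induction _ (R * R)%type
  [set A1 `*` A2 | A1 in measurable & A2 in measurable]
  (fun B => step_approximable (ind2 B))) gB.
- exact: measurable_prod_measurableType.
- move=> _ _ [A1 mA1 [A2 mA2 <-]] [B1 mB1 [B2 mB2 <-]].
  exists (A1 `&` B1); first exact: measurableI.
  exists (A2 `&` B2); first exact: measurableI.
  by rewrite setXI.
- rewrite (_ : ind2 _ = fun _ _ => 1); first exact: step_approximable_cst.
  by apply/funext => x; apply/funext => y; rewrite /ind2 indicE in_setT.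
- move=> _ [A mA [A' mA' <-]].
  rewrite (_ : ind2 _ = fun x y =>
    (fun k l : bool * bool => (k.1 && l.2)%:R) (x \in A, x \in A') (y \in A, y \in A')).
    apply: (@step_approximable_label _ (fun x => (x \in A, x \in A'))
      (fun k l : bool * bool => (k.1 && l.2)%:R)).
    by apply: measurable_label_pair; exact: measurable_label_mem.
  by apply/funext => x; apply/funext => y; rewrite /ind2 indicE in_setX.
- move=> S mS sS.
  rewrite (_ : ind2 _ = fun x y => 1 + -1 * ind2 S x y).
    have bS := bmeas2_ind2 mS.
    apply: step_approximableD; [exact: bmeas2_cst|exact: bmeas2Z|exact: step_approximable_cst|exact: step_approximableZ].
  apply/funext => x; apply/funext => y; rewrite /ind2 !indicE in_setC.
  by case: (_ \in S); rewrite /= ?mulr1 ?subrr// mulr0 addr0.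
- exact: step_approximable_bigcup.
Qed.

(** Rounding [F] down to a multiple of [1 / n] writes it, up to [1 / n], as a
    combination of indicators of level sets, which [step_approximable_ind2]
    covers. *)
Lemma step_approximable_bmeas F : bmeas2 F -> (forall x y, 0 <= F x y <= 1) -> step_approximable F.
Proof.
move=> bF F01; apply: step_approximable_limit => // e e0.
have [mF _] := bF.
pose n := (Num.truncn e^-1).+1.
have n0 : 0 < n%:R :> R by rewrite ltr0n.
have ne : n%:R^-1 <= e.
  rewrite -[e]invrK lef_pV2 ?posrE ?invr_gt0// ltW//.
  by apply: truncnS_gt.
pose B (j : 'I_n) := [set z : R * R | j.+1%:R <= n%:R * F z.1 z.2].
have mB j : measurable (B j).
  rewrite -[B j]setTI; apply: measurable_fun_le => //.
  by apply: measurable_funM.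
pose G x y := n%:R^-1 * \sum_(j < n) ind2 (B j) x y.
have bS : bmeas2 (fun x y => \sum_(j < n) ind2 (B j) x y).
  by apply: bmeas2_sum => j; exact: bmeas2_ind2.
exists G; split; first exact: bmeas2Z.
  apply: step_approximableZ => //; apply: step_approximable_sum => j; first exact: bmeas2_ind2.
  exact: step_approximable_ind2.
rewrite -[leRHS]avg2_cst; apply: le_avg2; [|exact: bmeas2_cst|].
  by apply: bmeas2_dist => //; exact: bmeas2Z.
move=> x y _ _; apply: le_trans ne.
have [F0 F1] := andP (F01 x y).
have nF0 : 0 <= n%:R * F x y by rewrite mulr_ge0// ltW.
have tF : (Num.truncn (n%:R * F x y) <= n)%N.
  rewrite -(ler_nat R) (le_trans (_ : _ <= n%:R * F x y)) ?truncn_le//.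
  by rewrite ler_piMr// ltW.
rewrite /G; have -> : \sum_(j < n) ind2 (B j) x y = (Num.truncn (n%:R * F x y))%:R.
  rewrite -(minn_idPr tF) -sum_ltn; apply: eq_bigr => j _.
  rewrite /ind2 indicE truncn_gt_nat; congr (_%:R : R); congr nat_of_bool.
  by apply/idP/idP => [/set_mem//|?]; exact/mem_set.
have /andP[lo hi] := truncn_itv nF0.
set T := (Num.truncn _)%:R in lo hi *.
have -> : F x y - n%:R^-1 * T = n%:R^-1 * (n%:R * F x y - T).
  by rewrite mulrBr mulKf// lt0r_neq0.
rewrite normrM ger0_norm ?invr_ge0 ?(ltW n0)// ler_piMr ?invr_ge0 ?(ltW n0)//.
rewrite ger0_norm ?subr_ge0// lerBlDl.
by rewrite -natr1 in hi; exact: ltW.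
Qed.

End StepDensity.

(** * Products of Bernoulli laws *)

Section BernoulliProduct.
Context {R : realType} (E : finType).
Implicit Types (b : E -> R) (X : {ffun E -> bool}) (F G : {ffun E -> bool} -> R).

Definition bern b X : R := \prod_e (if X e then b e else 1 - b e).

Definition Ex b F : R := \sum_X bern b X * F X.

Lemma bern_ge0 b X : (forall e, 0 <= b e <= 1) -> 0 <= bern b X.
Proof.
by move=> b01; apply: prodr_ge0 => e _; have := b01 e; case: (X e); lra.
Qed.

Lemma Ex_prod b (g : E -> bool -> R) :
  Ex b (fun X => \prod_e g e (X e)) = \prod_e (b e * g e true + (1 - b e) * g e false).
Proof.
pose f e (v : bool) := (if v then b e else 1 - b e) * g e v.
transitivity (\prod_e \sum_v f e v); last first.
  by apply: eq_bigr => e _; rewrite big_bool.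
rewrite bigA_distr_bigA; apply: eq_bigr => X _.
by rewrite /f big_split.
Qed.

Lemma ExD b F G : Ex b (fun X => F X + G X) = Ex b F + Ex b G.
Proof. by rewrite /Ex -big_split; apply: eq_bigr => X _; rewrite mulrDr. Qed.

Lemma ExZ b c F : Ex b (fun X => c * F X) = c * Ex b F.
Proof. by rewrite /Ex mulr_sumr; apply: eq_bigr => X _; rewrite mulrCA. Qed.

Lemma Ex_cst b c : Ex b (fun=> c) = c.
Proof.
have := Ex_prod b (fun _ _ => 1); rewrite [RHS]big1 => [|e _]; last by lra.
move=> E1; rewrite -[RHS]mulr1 -E1 -ExZ; congr (Ex b _); apply/funext => X.
by rewrite big1 ?mulr1.
Qed.

Lemma ExB b F G : Ex b (fun X => F X - G X) = Ex b F - Ex b G.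
Proof. by rewrite -mulN1r -ExZ -ExD; congr (Ex b _); apply/funext => X; rewrite mulN1r. Qed.

Lemma Ex_sum b (J : Type) (r : seq J) (P : pred J) (F : J -> {ffun E -> bool} -> R) :
  Ex b (fun X => \sum_(j <- r | P j) F j X) = \sum_(j <- r | P j) Ex b (F j).
Proof. by rewrite /Ex exchange_big; apply: eq_bigr => X _; rewrite mulr_sumr. Qed.

Lemma le_Ex b F G : (forall e, 0 <= b e <= 1) -> (forall X, F X <= G X) -> Ex b F <= Ex b G.
Proof. by move=> b01 FG; apply: ler_sum => X _; rewrite ler_wpM2l// bern_ge0. Qed.

(** Product functions with disjoint supports are uncorrelated, so that only
    overlapping pairs contribute to the variance of a sum of product functions. *)
Lemma variance_sum_prod b (J : finType) (Q : pred J) (g : J -> E -> bool -> R)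
    (overlap : rel J) (M : R) :
  (forall e, 0 <= b e <= 1) ->
  (forall j j' e, ~~ overlap j j' -> (forall v, g j e v = 1) \/ (forall v, g j' e v = 1)) ->
  (forall j X, `|\prod_e g j e (X e)| <= M) ->
  Ex b (fun X => (\sum_(j | Q j) \prod_e g j e (X e)
          - \sum_(j | Q j) \prod_e (b e * g j e true + (1 - b e) * g j e false)) ^+ 2)
  <= \sum_j \sum_j' (overlap j j')%:R * (2 * M) ^+ 2.
Proof.
move=> b01 disj gM.
pose P j X := \prod_e g j e (X e).
pose m j := Ex b (P j).
have mE j : m j = \prod_e (b e * g j e true + (1 - b e) * g j e false) by exact: Ex_prod.
have PM j X : `|P j X - m j| <= 2 * M.
  have mM : `|m j| <= M.
    rewrite ler_norml; apply/andP; split.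
      rewrite -[leLHS](Ex_cst b); apply: le_Ex => // Y.
      by have := gM j Y; rewrite ler_norml => /andP[].
    rewrite -[leRHS](Ex_cst b); apply: le_Ex => // Y.
    by have := gM j Y; rewrite ler_norml => /andP[].
  by rewrite (le_trans (ler_normB _ _))// mulr_natl mulr2n lerD// gM.
have -> : (fun X => (\sum_(j | Q j) \prod_e g j e (X e)
      - \sum_(j | Q j) \prod_e (b e * g j e true + (1 - b e) * g j e false)) ^+ 2) =
    (fun X => \sum_(j | Q j) \sum_(j' | Q j') (P j X - m j) * (P j' X - m j')).
  apply/funext => X; under [X in _ - X]eq_bigr do rewrite -mE.
  rewrite -sumrB expr2 mulr_suml; apply: eq_bigr => j _.
  by rewrite mulr_sumr.
rewrite Ex_sum big_mkcond/=; apply: ler_sum => j _; case: ifP => _; last first.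
  by apply: sumr_ge0 => j' _; rewrite mulr_ge0// exprn_even_ge0.
rewrite Ex_sum big_mkcond/=; apply: ler_sum => j' _; case: ifP => _; last first.
  by rewrite mulr_ge0// exprn_even_ge0.
have [ov|nov] := boolP (overlap j j').
  rewrite mul1r -[leRHS](Ex_cst b); apply: le_Ex => // X.
  rewrite (le_trans (ler_norm _))// normrM expr2 ler_pM//; exact: PM.
rewrite mul0r le_eqVlt; apply/orP; left; apply/eqP.
have -> : (fun X => (P j X - m j) * (P j' X - m j')) =
    (fun X => P j X * P j' X - (m j * P j' X + m j' * P j X - m j * m j')).
  by apply/funext => X; ring.
rewrite ExB ExB ExD !ExZ Ex_cst -/(m j) -/(m j').
suff -> : Ex b (fun X => P j X * P j' X) = m j * m j' by ring.
have -> : (fun X => P j X * P j' X) = (fun X => \prod_e (g j e (X e) * g j' e (X e))).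
  by apply/funext => X; rewrite big_split.
rewrite (Ex_prod b (fun e v => g j e v * g j' e v)) !mE -big_split/=.
apply: eq_bigr => e _; have [h|h] := disj _ _ e nov; rewrite !h; ring.
Qed.

Lemma prod_single (e : E) (f : E -> R) :
  \prod_e' (if e' == e then f e' else 1) = f e.
Proof. by rewrite -big_mkcond big_pred1_eq. Qed.

Lemma variance_linear b (c : E -> bool -> R) (M : R) :
  (forall e, 0 <= b e <= 1) -> (forall e v, `|c e v| <= M) ->
  Ex b (fun X => (\sum_e c e (X e) - \sum_e (b e * c e true + (1 - b e) * c e false)) ^+ 2)
  <= #|E|%:R * (2 * M) ^+ 2.
Proof.
move=> b01 cM.
pose g (e e' : E) v := if e' == e then c e' v else 1.
have gE e X : \prod_e' g e e' (X e') = c e (X e) by exact: prod_single.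
have gm e : \prod_e' (b e' * g e e' true + (1 - b e') * g e e' false) =
    b e * c e true + (1 - b e) * c e false.
  rewrite -[RHS](prod_single e (fun e => b e * c e true + (1 - b e) * c e false)).
  by apply: eq_bigr => e' _; rewrite /g; case: ifP => // _; ring.
have -> : (fun X => (\sum_e c e (X e) - \sum_e (b e * c e true + (1 - b e) * c e false)) ^+ 2) =
    (fun X => (\sum_e \prod_e' g e e' (X e') -
       \sum_e \prod_e' (b e' * g e e' true + (1 - b e') * g e e' false)) ^+ 2).
  apply/funext => X; congr ((_ - _) ^+ 2); apply: eq_bigr => e _; first by rewrite gE.
  by rewrite gm.
apply: (le_trans (@variance_sum_prod b E xpredT g (fun e e' => e == e') M b01 _ _)) => [j j' e jj'|j X|].
- rewrite /g; have [ej|] := eqVneq e j; last by left.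
  by right => v; rewrite ej (negbTE jj').
- by rewrite gE.
- have -> : #|E|%:R * (2 * M) ^+ 2 = \sum_(e : E) (2 * M) ^+ 2.
    by rewrite sumr_const mulr_natl.
  apply: ler_sum => e _.
  rewrite (bigD1 e)//= eqxx mul1r big1 ?addr0// => e' /negbTE.
  by rewrite eq_sym => ->; rewrite mul0r.
Qed.

(** Chebyshev's inequality and a union bound.  The three statistics will be the
    number of edges, the number of triangles and the log-likelihood. *)
Lemma three_chebyshev b (F1 F2 F3 : {ffun E -> bool} -> R) :
  (forall e, 0 <= b e <= 1) ->
  Ex b (fun X => F1 X ^+ 2) <= 1 / 6 -> Ex b (fun X => F2 X ^+ 2) <= 1 / 6 ->
  Ex b (fun X => F3 X ^+ 2) <= 1 / 6 ->
  1 / 2 <= \sum_(X | [&& `|F1 X| <= 1, `|F2 X| <= 1 & `|F3 X| <= 1]) bern b X.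
Proof.
move=> b01 h1 h2 h3.
pose good X := [&& `|F1 X| <= 1, `|F2 X| <= 1 & `|F3 X| <= 1].
have -> : \sum_(X | [&& `|F1 X| <= 1, `|F2 X| <= 1 & `|F3 X| <= 1]) bern b X =
    Ex b (fun X => (good X)%:R).
  by rewrite big_mkcond; apply: eq_bigr => X _; rewrite /good; case: ifP; rewrite ?mulr1 ?mulr0.
have /(le_Ex b01) : forall X, 1 - (F1 X ^+ 2 + F2 X ^+ 2 + F3 X ^+ 2) <= (good X)%:R.
  move=> X; have sq (x : R) : 1 < `|x| -> 1 < x ^+ 2.
    by move=> x1; rewrite -real_normK ?num_real// expr2; nra.
  have s1 := sqr_ge0 (F1 X); have s2 := sqr_ge0 (F2 X); have s3 := sqr_ge0 (F3 X).
  rewrite /good; have [_|/sq] := leP `|F1 X| 1; have [_|/sq] := leP `|F2 X| 1;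
    have [_|/sq] := leP `|F3 X| 1; rewrite /=; lra.
rewrite ExB !ExD Ex_cst; lra.
Qed.

End BernoulliProduct.

(** * Edges and triangles of a finite graph *)

Section GraphStatistics.
Context {R : realType} (n : nat).
Implicit Types (X : Omega n) (i j k : 'I_n) (e : edge_slot n) (G : 'I_n -> 'I_n -> R).

Lemma adjC X i j : adj X i j = adj X j i.
Proof. by rewrite /adj orbC. Qed.

Lemma adjii X i : adj X i i = false.
Proof. by rewrite /adj insubF ?ltnn. Qed.

Lemma adj_slot X e : adj X (val e).1 (val e).2 = X e.
Proof.
rewrite /adj -surjective_pairing valK/= insubF ?orbF//=.
by case: e => -[i j] /= ij; rewrite ltnNge ltnW.
Qed.

Definition adjR X i j : R := (adj X i j)%:R.

Definition on_slots G e : R := G (val e).1 (val e).2.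

Lemma big_slot (Z : Type) (idx : Z) (op : Monoid.com_law idx) (F : 'I_n * 'I_n -> Z) :
  \big[op/idx]_(e : edge_slot n) F (val e) =
  \big[op/idx]_(i < n) \big[op/idx]_(j < n | (i < j)%N) F (i, j).
Proof.
rewrite pair_big_dep/= [RHS](reindex_omap (val : edge_slot n -> _) insub).
  apply: eq_big => [e|e _]; first by rewrite valK eqxx andbT; case: e.
  by rewrite -surjective_pairing.
by move=> p ltp; rewrite insubT.
Qed.

Lemma sum_slot_sym G : (forall i j, G i j = G j i) ->
  \sum_(i < n) \sum_(j < n) G i j =
  \sum_(i < n) G i i + 2 * \sum_(e : edge_slot n) on_slots G e.
Proof.
move=> Gsym; rewrite /on_slots (big_slot _ (fun p => G p.1 p.2))/= mulr_natl mulr2n.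
have {2}-> : \sum_(i < n) \sum_(j < n | (i < j)%N) G i j =
    \sum_(i < n) \sum_(j < n | (j < i)%N) G i j.
  rewrite (exchange_big_dep xpredT)//=; apply: eq_bigr => j _.
  by apply: eq_bigr => i _; exact: Gsym.
rewrite -!big_split/=; apply: eq_bigr => i _; rewrite (bigD1 i)//=; congr (_ + _).
rewrite (bigID (fun j : 'I_n => (i < j)%N))/=; congr (_ + _).
  by apply: eq_bigl => j; rewrite -val_eqE/=; lia.
by apply: eq_bigl => j; rewrite -val_eqE/=; lia.
Qed.

Lemma sum_offdiag G : \sum_(i < n) \sum_(j < n) (i != j)%:R * G i j =
  \sum_(i < n) \sum_(j < n) G i j - \sum_(i < n) G i i.
Proof.
rewrite -sumrB; apply: eq_bigr => i _; rewrite (bigD1 i)//= [in RHS](bigD1 i)//=.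
rewrite eqxx mul0r add0r addrAC subrr add0r; apply: eq_bigr => j ji.
by rewrite eq_sym ji mul1r.
Qed.

Definition vertices (t : 'I_n * 'I_n * 'I_n) : seq 'I_n := [:: t.1.1; t.1.2; t.2].

(** For three distinct vertices, these are the three edges of the triangle. *)
Definition slot_within (t : 'I_n * 'I_n * 'I_n) e : bool :=
  ((val e).1 \in vertices t) && ((val e).2 \in vertices t).

Definition tri G (t : 'I_n * 'I_n * 'I_n) : R := G t.1.1 t.1.2 * G t.1.2 t.2 * G t.1.1 t.2.

Lemma sum_triples (F : 'I_n * 'I_n * 'I_n -> R) :
  \sum_t F t = \sum_(i < n) \sum_(j < n) \sum_(k < n) F (i, j, k).
Proof.
rewrite pair_big pair_big; apply: eq_bigr => -[[i j] k] _ //.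
Qed.

Lemma prod_slot_within G (t : 'I_n * 'I_n * 'I_n) : (forall i j, G i j = G j i) ->
  uniq (vertices t) ->
  \prod_e (if slot_within t e then on_slots G e else 1) = tri G t.
Proof.
move=> Gsym ut; rewrite /slot_within.
rewrite /on_slots (big_slot _ (fun p => if (p.1 \in vertices t) && (p.2 \in vertices t) then G p.1 p.2 else 1))/=.
transitivity (\prod_(i <- vertices t) \prod_(j <- vertices t) if (i < j)%N then G i j else 1).
  rewrite (big_uniq _ ut)/= [RHS]big_mkcond; apply: eq_bigr => i _.
  case: ifP => it; last by rewrite big1.
  rewrite (big_uniq _ ut)/= big_mkcond [RHS]big_mkcond; apply: eq_bigr => j _.
  by case: ifP; case: ifP => //=; case: ifP.
move: ut; rewrite /tri /vertices; case: t => -[i j] k /=.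
rewrite !inE !negb_or -!val_eqE/= => /andP[/andP[ij ik] /andP[jk _]].
rewrite !big_cons !big_nil !ltnn.
by case: (ltngtP i j) ij => // _ _; case: (ltngtP i k) ik => // _ _;
  case: (ltngtP j k) jk => // _ _; rewrite ?(Gsym j i) ?(Gsym k i) ?(Gsym k j); ring.
Qed.

Definition share_vertex (t t' : 'I_n * 'I_n * 'I_n) : bool := has (mem (vertices t')) (vertices t).

Lemma sum_eq_ord (i : 'I_n) : \sum_(j < n) (i == j)%:R = 1 :> R.
Proof.
by rewrite (bigD1 i)//= eqxx big1 ?addr0// => j /negbTE; rewrite eq_sym => ->.
Qed.

(** Each of the nine ways for two triples to share a vertex leaves five free
    indices.  This is one order of magnitude less than all [n ^ 6] pairs, which
    is why the number of triangles concentrates. *)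
Lemma sum_share_vertex :
  \sum_t \sum_t' (share_vertex t t')%:R <= 9 * n%:R ^+ 5 :> R.
Proof.
have row (i : 'I_n) : \sum_t' (\sum_(y <- vertices t') (i == y)%:R) = 3 * n%:R ^+ 2 :> R.
  rewrite sum_triples; under eq_bigr do under eq_bigr do under eq_bigr do
    rewrite !big_cons big_nil/= addr0.
  under eq_bigr do under eq_bigr do rewrite !big_split/= !sumr_const card_ord sum_eq_ord.
  under eq_bigr do rewrite !big_split/= !sumr_const card_ord !sumrMnl sum_eq_ord.
  rewrite !big_split/= !sumr_const card_ord !sumrMnl sum_eq_ord.
  by rewrite -!mulrnA !natrM; ring.
have le1 t t' : (share_vertex t t')%:R <= \sum_(x <- vertices t) \sum_(y <- vertices t') (x == y)%:R :> R.
  case sh: (share_vertex t t'); last by apply: sumr_ge0 => x _; apply: sumr_ge0.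
  have /hasP[x xt /= xt'] := sh.
  rewrite (big_rem x)//= (big_rem x xt')/= eqxx -addrA lerDl addr_ge0//.
    by apply: sumr_ge0.
  by apply: sumr_ge0 => y _; apply: sumr_ge0.
apply: (@le_trans _ _ (\sum_t \sum_(x <- vertices t) (3 * n%:R ^+ 2))).
  apply: ler_sum => t _; under [leRHS]eq_bigr => i _ do rewrite -(row i).
  by rewrite exchange_big; apply: ler_sum => t' _; exact: le1.
under eq_bigr do rewrite !big_cons big_nil.
rewrite sumr_const (_ : #|_| = (n * n * n)%N); last by rewrite !card_prod card_ord.
rewrite -[leLHS]mulr_natl !natrM le_eqVlt; apply/orP; left.
by apply/eqP; ring.
Qed.

Lemma card_slot : (#|{: edge_slot n}| <= n * n)%N.
Proof.
by rewrite card_sub (leq_trans (max_card _))// card_prod card_ord.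
Qed.

End GraphStatistics.

(** * Concentration of random graphs *)

Section TypicalGraphs.
Context {R : realType}.

Definition eta (u : R) : R := u * ln u.

Definition log_bern (E : finType) (b : E -> R) (X : {ffun E -> bool}) : R :=
  \sum_e (if X e then ln (b e) else ln (1 - b e)).

(** If an edge probability is [0] or [1], the convention [ln 0 = 0] matters only
    for graphs of probability zero; hence an inequality. *)
Lemma bern_le_expR (E : finType) (b : E -> R) (X : {ffun E -> bool}) :
  (forall e, 0 <= b e <= 1) -> bern b X <= expR (log_bern b X).
Proof.
move=> b01; rewrite /bern /log_bern expR_sum; apply: ler_prod => e _.
have le_expln (u : R) : 0 <= u -> 0 <= u <= expR (ln u).
  move=> u0; rewrite u0/=; have [u1|u1] := ltP 0 u; first by rewrite lnK.
  by rewrite (le_trans u1)// expR_ge0.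
by have := b01 e; case: (X e) => /andP[b0 b1]; apply: le_expln => //; rewrite subr_ge0.
Qed.

Lemma Ex_sqr_scaled (E : finType) (b : E -> R) (D : {ffun E -> bool} -> R) (V K : R) :
  0 < K -> Ex b (fun X => D X ^+ 2) <= V -> 6 * V <= K ^+ 2 ->
  Ex b (fun X => (D X / K) ^+ 2) <= 1 / 6.
Proof.
move=> K0 DV VK; have -> : (fun X => (D X / K) ^+ 2) = (fun X => K ^- 2 * D X ^+ 2).
  by apply/funext => X; rewrite expr_div_n mulrC.
by rewrite ExZ ler_pdivrMl ?exprn_gt0//; lra.
Qed.

(** The thresholds for [n] make each variance at most one sixth of the squared
    tolerance: adjacent ordered pairs have variance at most [16 n^2], ordered
    triangles at most [36 n^5], the log-likelihood at most [4 C^2 n^2]. *)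
Lemma typical_graphs (n : nat) (f : 'I_n -> 'I_n -> R) (C eps : R) :
  (forall i j, f i j = f j i) -> (forall i j, 0 <= f i j <= 1) ->
  (forall i j, `|ln (f i j)| <= C /\ `|ln (1 - f i j)| <= C) ->
  (0 < n)%N -> 0 < eps -> 216 <= n%:R * eps ^+ 2 -> 24 * C ^+ 2 <= n%:R * eps ^+ 2 ->
  1 / 2 <= \sum_(X : Omega n |
    [&& `|\sum_(i < n) \sum_(j < n) adjR X i j - \sum_(i < n) \sum_(j < n) (i != j)%:R * f i j|
          <= eps * n%:R ^+ 2,
        `|\sum_t tri (adjR X) t - \sum_t (uniq (vertices t))%:R * tri f t| <= eps * n%:R ^+ 3 &
        `|log_bern (on_slots f) X - \sum_e (eta (on_slots f e) + eta (1 - on_slots f e))| <= eps * n%:R ^+ 2])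
    bern (on_slots f) X.
Proof.
move=> fsym f01 fC n0 e0 n216 n24.
pose b := on_slots f; pose A := @adjR R n.
have b01 e : 0 <= b e <= 1 by exact: f01.
have N0 : 0 < n%:R :> R by rewrite ltr0n.
have N1 : 1 <= n%:R :> R by rewrite ler1n.
have Asym X i j : A X i j = A X j i by rewrite /A /adjR adjC.
have slotN : #|{: edge_slot n}|%:R <= n%:R ^+ 2 :> R.
  by rewrite expr2 -natrM ler_nat card_slot.
pose D1 X := \sum_(i < n) \sum_(j < n) A X i j - \sum_(i < n) \sum_(j < n) (i != j)%:R * f i j.
pose D2 X := \sum_t tri (A X) t - \sum_t (uniq (vertices t))%:R * tri f t.
pose D3 X := log_bern b X - \sum_e (eta (b e) + eta (1 - b e)).
have K0 m : 0 < eps * n%:R ^+ m by rewrite mulr_gt0// exprn_gt0.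
have V1 : Ex b (fun X => D1 X ^+ 2) <= n%:R ^+ 2 * 16.
  have -> : (fun X => D1 X ^+ 2) = fun X => 4 * (\sum_e (X e)%:R -
      \sum_e (b e * true%:R + (1 - b e) * false%:R)) ^+ 2.
    apply/funext => X; rewrite /D1 sum_offdiag !sum_slot_sym//.
    rewrite big1 ?add0r => [|i _]; last by rewrite /A /adjR adjii.
    rewrite addrAC subrr add0r -mulrBr exprMn; congr (_ * _ ^+ 2); first by ring.
    congr (_ - _); apply: eq_bigr => e _; first by rewrite /A /on_slots /adjR adj_slot.
    by rewrite /b /=; ring.
  rewrite ExZ; have := @variance_linear R _ b (fun _ v => v%:R) 1 b01.
  rewrite mulr1 => /(_ _)/le_trans VL.
  rewrite (_ : n%:R ^+ 2 * 16 = 4 * (n%:R ^+ 2 * 2 ^+ 2)); last by ring.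
  rewrite ler_wpM2l//; apply: VL => [_ [] /=|]; rewrite ?normr1 ?normr0//.
  by rewrite ler_wpM2r.
have V2 : Ex b (fun X => D2 X ^+ 2) <= 36 * n%:R ^+ 5.
  pose g (t : 'I_n * 'I_n * 'I_n) e (v : bool) : R := if slot_within t e then v%:R else 1.
  have gX t (X : Omega n) : uniq (vertices t) -> \prod_e g t e (X e) = tri (A X) t.
    move=> ut; rewrite -(prod_slot_within (Asym X) ut).
    by apply: eq_bigr => e _; rewrite /g /on_slots /A /adjR adj_slot.
  have gb t : uniq (vertices t) ->
      \prod_e (b e * g t e true + (1 - b e) * g t e false) = tri f t.
    move=> ut; rewrite -(prod_slot_within fsym ut).
    by apply: eq_bigr => e _; rewrite /g /b /=; case: ifP => _; ring.
  have -> : (fun X => D2 X ^+ 2) = fun X => (\sum_(t | uniq (vertices t)) \prod_e g t e (X e) -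
      \sum_(t | uniq (vertices t)) \prod_e (b e * g t e true + (1 - b e) * g t e false)) ^+ 2.
    apply/funext => X; congr ((_ - _) ^+ 2); rewrite [RHS]big_mkcond; apply: eq_bigr => t _.
      case: ifP => [ut|]; first by rewrite gX.
      rewrite /vertices/= !inE ?andbT => /negbT; rewrite !negb_and !negbK => h.
      rewrite /tri /A /adjR; case: t h => -[i j] k /= /orP[/orP[/eqP->|/eqP->]|/eqP->];
        by rewrite adjii mulr0n !(mul0r, mulr0).
    by case: ifP => [ut|_]; rewrite ?mul0r// mul1r gb.
  apply: (le_trans (@variance_sum_prod _ _ b _ _ g (@share_vertex n) 1 b01 _ _)).
  - move=> t t' e nov; rewrite /g; case w: (slot_within t e); last by left.
    case w' : (slot_within t' e); last by right.
    exfalso; move/negP: nov; apply; apply/hasP; exists (val e).1.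
      by case/andP: w.
    by case/andP: w'.
  - move=> t X; rewrite normr_prod; apply: prodr_ile1 => e; rewrite normr_ge0/= /g.
    by case: ifP => _; [case: (X e)|]; rewrite ?normr1 ?normr0.
  - rewrite mulr1; under eq_bigr do rewrite -mulr_suml; rewrite -mulr_suml.
    by have := @sum_share_vertex R n; lra.
have V3 : Ex b (fun X => D3 X ^+ 2) <= n%:R ^+ 2 * (2 * C) ^+ 2.
  pose c e (v : bool) := if v then ln (b e) else ln (1 - b e).
  apply: le_trans (_ : #|{: edge_slot n}|%:R * (2 * C) ^+ 2 <= _); last first.
    by rewrite ler_wpM2r// exprn_even_ge0.
  apply: (@variance_linear R _ b c C b01) => e v; rewrite /c /b.
  by have [h h'] := fC (val e).1 (val e).2; case: v.
have K2 m : (eps * n%:R ^+ m) ^+ 2 = eps ^+ 2 * n%:R ^+ m.*2.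
  by rewrite exprMn -exprM muln2.
have N2 : n%:R <= n%:R ^+ 2 :> R by rewrite expr2 ler_peMr// ltW.
have := @three_chebyshev R _ b (fun X => D1 X / (eps * n%:R ^+ 2))
  (fun X => D2 X / (eps * n%:R ^+ 3)) (fun X => D3 X / (eps * n%:R ^+ 2)) b01.
have Kd m (x : R) : (`|x / (eps * n%:R ^+ m)| <= 1) = (`|x| <= eps * n%:R ^+ m).
  by rewrite normrM normfV (gtr0_norm (K0 m)) ler_pdivrMr// mul1r.
under [X in _ -> _ -> _ -> _ <= X]eq_bigl do rewrite !Kd.
apply; [apply: Ex_sqr_scaled V1 _|apply: Ex_sqr_scaled V2 _|apply: Ex_sqr_scaled V3 _] => //.
- rewrite K2 (_ : 2.*2 = (2 + 2)%N)// exprD; have := ler_wpM2r (sqr_ge0 n%:R) n216.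
  have := ler_wpM2l (sqr_ge0 eps) (ler_wpM2r (sqr_ge0 n%:R) N2).
  nra.
- rewrite K2 (_ : 3.*2 = (1 + 5)%N)// exprD; have := ler_wpM2r (exprn_ge0 5 (ltW N0)) n216.
  rewrite expr1; lra.
- rewrite K2 (_ : 2.*2 = (2 + 2)%N)// exprD; have := ler_wpM2r (sqr_ge0 n%:R) n24.
  have := ler_wpM2l (sqr_ge0 eps) (ler_wpM2r (sqr_ge0 n%:R) N2).
  nra.
Qed.

End TypicalGraphs.

(** * Vertices labelled according to a step kernel *)

Section StepCounting.
Context {R : realType} (L : finType).
Implicit Types (w : L -> R) (G : L -> R).

Definition wsum w G : R := \sum_k w k * G k.

Definition wsum2 w (G : L -> L -> R) : R := wsum w (fun k => wsum w (G k)).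

Definition wsum3 w (G : L -> L -> L -> R) : R := wsum w (fun k => wsum2 w (G k)).

Lemma wsum_bound w G (M : R) : (forall k, 0 <= w k) -> \sum_k w k = 1 ->
  (forall k, `|G k| <= M) -> `|wsum w G| <= M.
Proof.
move=> w0 w1 GM; rewrite (le_trans (ler_norm_sum _ _ _))//.
rewrite -[leRHS]mul1r -w1 mulr_suml; apply: ler_sum => k _.
by rewrite normrM ger0_norm// ler_wpM2l.
Qed.

Definition label_error : R := 2 * #|L|%:R.

(** Weighted sums over labels become sums over vertices up to a bounded error.
    Give [truncn (n * w k)] vertices the label [k]; the at most [#|L|] vertices
    left over by the rounding all receive the same label. *)
Lemma label_vertices w n : (forall k, 0 <= w k) -> \sum_k w k = 1 ->
  exists s : 'I_n -> L, forall G (M : R), (forall k, `|G k| <= M) ->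
    `|\sum_(i < n) G (s i) - n%:R * wsum w G| <= label_error * M.
Proof.
move=> w0 w1; have [k0 _] : exists k0 : L, True.
  have [k0 _|L0] := pickP (fun _ : L => true); first by exists k0.
  by move: w1; rewrite big1 => [/eqP|k]; [rewrite eq_sym oner_eq0|have := L0 k].
pose m k := Num.truncn (n%:R * w k).
have nw0 k : 0 <= n%:R * w k by rewrite mulr_ge0.
have mlo k : (m k)%:R <= n%:R * w k by rewrite truncn_le.
have mhi k : n%:R * w k <= (m k)%:R + 1.
  by rewrite natr1 ltW// truncnS_gt.
have nE : n%:R = \sum_k n%:R * w k by rewrite -mulr_sumr w1 mulr1.
have mn : (\sum_k m k <= n)%N.
  by rewrite -(ler_nat R) natr_sum nE; apply: ler_sum => k _; exact: mlo.
have rest : (n - \sum_k m k)%:R <= #|L|%:R :> R.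
  rewrite natrB// natr_sum nE -sumrB -sumr_const; apply: ler_sum => k _.
  by rewrite lerBlDl mhi.
pose sq := flatten [seq nseq (m k) k | k <- enum L] ++ nseq (n - \sum_k m k) k0.
have sumsq (F : L -> R) : \sum_(x <- sq) F x =
    \sum_k (m k)%:R * F k + (n - \sum_k m k)%:R * F k0.
  rewrite big_cat/=; congr (_ + _); last by rewrite big_nseq iter_addr_0 mulr_natl.
  rewrite big_flatten/= big_map big_enum/=; apply: eq_bigr => k _.
  by rewrite big_nseq iter_addr_0 mulr_natl.
have szsq : size sq = n.
  rewrite size_cat size_flatten size_nseq /shape -map_comp sumnE big_map big_enum/=.
  under eq_bigr do rewrite /= size_nseq.
  by rewrite subnKC.
exists (fun i : 'I_n => nth k0 sq i) => G M GM.
have M0 := le_trans (normr_ge0 _) (GM k0).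
have -> : \sum_(i < n) G (nth k0 sq i) = \sum_(x <- sq) G x.
  by rewrite (big_nth k0) szsq big_mkord.
rewrite sumsq addrAC /wsum mulr_sumr -sumrB.
have -> : label_error * M = #|L|%:R * M + #|L|%:R * M by rewrite /label_error; ring.
rewrite (le_trans (ler_normD _ _))// lerD//.
  rewrite (le_trans (ler_norm_sum _ _ _))// -sumr_const mulr_suml; apply: ler_sum => k _.
  rewrite mulrA -mulrBl normrM mul1r -[leRHS]mul1r ler_pM//.
  by rewrite distrC ger0_norm ?subr_ge0// lerBlDl.
by rewrite normrM ger0_norm// ler_pM.
Qed.

Variables (n : nat) (s : 'I_n -> L) (w : L -> R) (c : R).
Hypotheses (w0 : forall k, 0 <= w k) (w1 : \sum_k w k = 1).
Hypothesis sP : forall G (M : R), (forall k, `|G k| <= M) ->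
  `|\sum_(i < n) G (s i) - n%:R * wsum w G| <= c * M.

Lemma label_sum2 (G : L -> L -> R) M : (forall k l, `|G k l| <= M) ->
  `|\sum_(i < n) \sum_(j < n) G (s i) (s j) - n%:R ^+ 2 * wsum2 w G|
  <= 2 * c * n%:R * M.
Proof.
move=> GM.
have h2 := sP (fun k => wsum_bound w0 w1 (GM k)).
have h1 : `|\sum_(i < n) (\sum_(j < n) G (s i) (s j) - n%:R * wsum w (G (s i)))| <= n%:R * (c * M).
  rewrite (le_trans (ler_norm_sum _ _ _))//.
  apply: le_trans (_ : \sum_(i < n) (c * M) <= _).
    by apply: ler_sum => i _; exact: sP.
  by rewrite sumr_const card_ord -[leLHS]mulr_natl.
rewrite sumrB -mulr_sumr in h1.
set A := \sum_(i < n) \sum_(j < n) _ in h1 *; set B := \sum_(i < n) wsum w _ in h1 h2.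
set D := wsum w _ in h2 *.
have -> : A - n%:R ^+ 2 * D = (A - n%:R * B) + n%:R * (B - n%:R * D) by ring.
rewrite (le_trans (ler_normD _ _))// normrM ger0_norm//.
have := ler_wpM2l (ler0n R n) h2; lra.
Qed.

Lemma label_sum3 (G : L -> L -> L -> R) M : (forall k l m, `|G k l m| <= M) ->
  `|\sum_(i < n) \sum_(j < n) \sum_(k < n) G (s i) (s j) (s k)
    - n%:R ^+ 3 * wsum3 w G|
  <= 3 * c * n%:R ^+ 2 * M.
Proof.
move=> GM.
have h2 := sP (fun k => wsum_bound w0 w1 (fun l => wsum_bound w0 w1 (GM k l))).
have h1 : `|\sum_(i < n) (\sum_(j < n) \sum_(k < n) G (s i) (s j) (s k)
      - n%:R ^+ 2 * wsum w (fun l => wsum w (G (s i) l)))| <= n%:R * (2 * c * n%:R * M).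
  rewrite (le_trans (ler_norm_sum _ _ _))//.
  apply: le_trans (_ : \sum_(i < n) (2 * c * n%:R * M) <= _).
    by apply: ler_sum => i _; exact: label_sum2.
  by rewrite sumr_const card_ord -[leLHS]mulr_natl.
rewrite sumrB -mulr_sumr in h1.
set A := \sum_(i < n) \sum_(j < n) _ in h1 *; set B := \sum_(i < n) wsum w _ in h1 h2.
set D := wsum w _ in h2 *.
have -> : A - n%:R ^+ 3 * D = (A - n%:R ^+ 2 * B) + n%:R ^+ 2 * (B - n%:R * D) by ring.
rewrite (le_trans (ler_normD _ _))// normrM ger0_norm ?exprn_ge0//.
have := ler_wpM2l (exprn_ge0 2 (ler0n R n)) h2; lra.
Qed.

End StepCounting.

(** * Counting the graphs close to a step kernel *)

Section CountStep.
Context {R : realType}.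

Lemma eta_bound (u C : R) : 0 <= u <= 1 -> `|ln u| <= C -> `|eta u| <= C.
Proof.
move=> /andP[u0 u1] uC; rewrite /eta normrM ger0_norm//.
by apply: le_trans uC; rewrite ler_piMl.
Qed.

(** Minus one half of the binary entropy, hence nonpositive on [[0, 1]]. *)
Definition neg_entropy_fun (u : R) : R := 2^-1 * (eta u + eta (1 - u)).

Lemma sum_not_uniq n (f : 'I_n -> 'I_n -> R) : (forall i j, 0 <= f i j <= 1) ->
  `|\sum_t (uniq (vertices t))%:R * tri f t - \sum_t tri f t| <= 3 * n%:R ^+ 2.
Proof.
move=> f01; rewrite -sumrB (le_trans (ler_norm_sum _ _ _))//.
have tri01 t : `|tri f t| <= 1.
  have f1 i j : `|f i j| <= 1 by have := f01 i j; rewrite ler_norml; lra.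
  by rewrite /tri !normrM; do 2 (rewrite mulr_ile1 ?mulr_ge0//).
have le1 (t : 'I_n * 'I_n * 'I_n) : `|(uniq (vertices t))%:R * tri f t - tri f t| <=
    (t.1.1 == t.1.2)%:R + (t.1.1 == t.2)%:R + (t.1.2 == t.2)%:R.
  rewrite -[X in _ - X]mul1r -mulrBl normrM.
  apply: (@le_trans _ _ (`|(uniq (vertices t))%:R - 1| : R)); first by rewrite ler_piMr.
  rewrite /vertices/= !inE andbT negb_or.
  by case: eqP => _; case: eqP => _; case: eqP => _ /=;
    rewrite ?subrr ?sub0r ?normrN ?normr0 ?normr1; lra.
apply: le_trans (ler_sum _ (fun t _ => le1 t)) _.
rewrite sum_triples; under eq_bigr do under eq_bigr do rewrite !big_split/= sumr_const card_ord !sum_eq_ord.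
under eq_bigr do rewrite !big_split/= !sumr_const card_ord sumrMnl sum_eq_ord.
rewrite !big_split/= !sumr_const card_ord le_eqVlt; apply/orP; left; apply/eqP.
by rewrite -!mulrnA !natrM; ring.
Qed.

(** Each typical graph has probability at most [exp (n^2 (H + o(1)))], where [H]
    is the negative entropy of the step kernel, and together they have
    probability at least one half; so they number at least
    [exp (- n^2 (H + o(1)))]. *)
Lemma count_step (L : finType) (w : L -> R) (a : L -> L -> R) (eps : R) :
  (forall k, 0 <= w k) -> \sum_k w k = 1 ->
  (forall k l, a k l = a l k) -> (forall k l, 0 <= a k l <= 1) -> 0 < eps ->
  \forall n \near \oo,
    expR (- (n%:R ^+ 2 * (wsum2 w (fun k l => neg_entropy_fun (a k l)) + eps)))
    <= \sum_(X : Omega n |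
        (`|\sum_(i < n) \sum_(j < n) adjR X i j - n%:R ^+ 2 * wsum2 w a|
          <= eps * n%:R ^+ 2) &&
        (`|\sum_t tri (adjR X) t
           - n%:R ^+ 3 * wsum3 w (fun k l m => a k l * a l m * a k m)|
          <= eps * n%:R ^+ 3)) 1.
Proof.
move=> w0 w1 asym a01 eps0.
pose C := \sum_k \sum_l (`|ln (a k l)| + `|ln (1 - a k l)|).
have aC k l : `|ln (a k l)| <= C /\ `|ln (1 - a k l)| <= C.
  suff : `|ln (a k l)| + `|ln (1 - a k l)| <= C.
    by have := normr_ge0 (ln (a k l)); have := normr_ge0 (ln (1 - a k l)); lra.
  rewrite /C (bigD1 k)//= (bigD1 l)//= -addrA lerDl addr_ge0//.
    by apply: sumr_ge0 => l' _; rewrite addr_ge0.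
  by apply: sumr_ge0 => k' _; apply: sumr_ge0 => l' _; rewrite addr_ge0.
have C0 : 0 <= C by apply: sumr_ge0 => k _; apply: sumr_ge0 => l _; rewrite addr_ge0.
pose c : R := @label_error R L; have c0 : 0 <= c by rewrite /c /label_error mulr_ge0.
pose d := eps / 3; have d0 : 0 < d by rewrite divr_gt0.
pose K := 2 * c * C + C.
have d20 : 0 < d ^+ 2 by rewrite exprn_gt0.
near=> n.
have n0 : (0 < n)%N by near: n; exact: nbhs_infty_gt.
have n216 : 216 <= n%:R * d ^+ 2.
  by rewrite -ler_pdivrMr//; near: n; exact: nbhs_infty_ger.
have n24 : 24 * C ^+ 2 <= n%:R * d ^+ 2.
  by rewrite -ler_pdivrMr//; near: n; exact: nbhs_infty_ger.
have nK : 3 + 3 * c + K <= n%:R * d.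
  by rewrite -ler_pdivrMr//; near: n; exact: nbhs_infty_ger.
have N1 : 1 <= n%:R :> R by rewrite ler1n.
have K0 : 0 <= K by rewrite /K; have := mulr_ge0 c0 C0; lra.
have epsE : eps = 3 * d by rewrite /d mulrC divfK.
have n1 : n%:R <= n%:R ^+ 2 :> R by rewrite expr2 ler_peMr.
have cn0 : 0 <= c * n%:R by rewrite mulr_ge0.
have Kn0 : 0 <= K * n%:R by rewrite mulr_ge0.
have nK2 : (3 + 3 * c + K) * n%:R <= d * n%:R ^+ 2.
  by rewrite expr2 mulrA [d * _]mulrC ler_wpM2r.
have nK3 : (3 + 3 * c + K) * n%:R ^+ 2 <= d * n%:R ^+ 3.
  by rewrite (exprS _ 2) mulrA [d * _]mulrC ler_wpM2r// exprn_ge0.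
have Kn02 : 0 <= K * n%:R ^+ 2 by rewrite mulr_ge0// exprn_ge0.
have [s sP] := label_vertices n w0 w1; rewrite -/c in sP.
pose f (i j : 'I_n) := a (s i) (s j).
have fC (i j : 'I_n) := aC (s i) (s j).
have h2C k l : `|eta (a k l) + eta (1 - a k l)| <= 2 * C.
  have [u v] := aC k l; rewrite (le_trans (ler_normD _ _))// mulr_natl mulr2n lerD// eta_bound//.
  by have := a01 k l; lra.
have f01 i j : 0 <= f i j <= 1 by exact: a01.
have fsym i j : f i j = f j i by exact: asym.
have := typical_graphs fsym f01 fC n0 d0 n216 n24.
set S := \sum_(X | _) _ => S12.
have LE : S <= expR (n%:R ^+ 2 * wsum2 w (fun k l => neg_entropy_fun (a k l))
   + K * n%:R + d * n%:R ^+ 2) * \sum_(X : Omega n |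
        (`|\sum_(i < n) \sum_(j < n) adjR X i j - n%:R ^+ 2 * wsum2 w a|
          <= eps * n%:R ^+ 2) &&
        (`|\sum_t tri (adjR X) t
           - n%:R ^+ 3 * wsum3 w (fun k l m => a k l * a l m * a k m)|
          <= eps * n%:R ^+ 3)) 1.
  rewrite mulr_sumr /S big_mkcond [leRHS]big_mkcond; apply: ler_sum => X _.
  case: ifP => [/and3P[g1 g2 g3]|_]; last by case: ifP => // _; rewrite mulr1 expR_ge0.
  have a1 k l : `|a k l| <= 1 by have := a01 k l; rewrite ler_norml; lra.
  have e1 : `|\sum_(i < n) f i i| <= n%:R.
    rewrite (le_trans (ler_norm_sum _ _ _))//.
    apply: (@le_trans _ _ (\sum_(i < n) 1)); first by apply: ler_sum => i _; exact: a1.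
    by rewrite sumr_const card_ord.
  have e2 := label_sum2 w0 w1 sP a1.
  have t1 := sum_not_uniq f01.
  have t2 := @label_sum3 R L n s w c w0 w1 sP (fun k l m => a k l * a l m * a k m) 1.
  have {}t2 := t2 (fun k l m => _).
  have {}t2 : `|\sum_t tri f t - n%:R ^+ 3 * wsum3 w (fun k l m => a k l * a l m * a k m)| <= 3 * c * n%:R ^+ 2.
    rewrite sum_triples -[leRHS]mulr1; apply: t2 => k l m.
    by rewrite !normrM; do 2 (rewrite mulr_ile1 ?mulr_ge0//).
  have l1 : `|\sum_(i < n) (eta (f i i) + eta (1 - f i i))| <= n%:R * (2 * C).
    rewrite (le_trans (ler_norm_sum _ _ _))//.
    apply: (@le_trans _ _ (\sum_(i < n) (2 * C))); first by apply: ler_sum => i _; exact: h2C.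
    by rewrite sumr_const card_ord -[leLHS]mulr_natl.
  have l2 := label_sum2 w0 w1 sP h2C.
  have hs i j : eta (f i j) + eta (1 - f i j) = eta (f j i) + eta (1 - f j i) by rewrite fsym.
  have l3 := sum_slot_sym hs.
  have wE : wsum2 w (fun k l => eta (a k l) + eta (1 - a k l)) =
      2 * wsum2 w (fun k l => neg_entropy_fun (a k l)).
    rewrite /wsum2 /wsum !mulr_sumr; apply: eq_bigr => k _.
    rewrite mulrCA !mulr_sumr; apply: eq_bigr => l _.
    by rewrite /neg_entropy_fun; field.
  rewrite wE in l2.
  have b01 e : 0 <= on_slots f e <= 1 by exact: a01.
  have lb := bern_le_expR X b01.
  move: g1 g2 g3; rewrite sum_offdiag => g1 g2 g3.
  rewrite ifT; last first.
    apply/andP; split.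
      move: g1 e1 e2; rewrite !ler_norml /f; set SA := \sum_(i < n) \sum_(j < n) adjR X i j.
      set SF := \sum_(i < n) \sum_(j < n) _; set SD := \sum_(i < n) _; set EE := wsum2 _ _.
      rewrite epsE; lra.
    move: g2 t1 t2; rewrite !ler_norml; set SA := \sum_t tri (adjR X) t.
    set SF := \sum_t tri f t; set SD := \sum_t _; set EE := wsum3 _ _.
    rewrite epsE; lra.
  rewrite mulr1 (le_trans lb)// ler_expR.
  move: g3 l1 l2 l3; rewrite !ler_norml /on_slots /f; set HS := wsum2 w _.
  set SF := \sum_(i < n) \sum_(j < n) _; set SD := \sum_(i < n) _; set SE := \sum_e _.
  move=> g3 l1 l2 l3; rewrite /K; lra.
set B := _ + d * _ in LE; set Cnt := \sum_(X | _) _ in LE *.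
have e1 : expR (-1) <= 1 / 2 :> R.
  by rewrite expRN div1r lef_pV2 ?posrE ?expR_gt0//; have := expR_ge1Dx (1 : R); lra.
apply: (@le_trans _ _ (expR (- B) * expR (-1))).
  by rewrite -expRD ler_expR /B epsE; lra.
apply: (@le_trans _ _ (expR (- B) * (expR B * Cnt))).
  by rewrite ler_wpM2l ?expR_ge0// (le_trans e1)// (le_trans S12).
by rewrite mulrA -expRD addNr expR0 mul1r.
Unshelve. all: by end_near. Qed.

End CountStep.

(** * Densities as iterated averages *)

Section TripleAverages.
Context {R : realType}.
Local Notation I01 := (`[0, 1]%classic : set R).
Local Notation mu := (@lebesgue_measure R).
Implicit Types f g : R -> R -> R.

(** Transposing a step approximation of a symmetric kernel must not change its
    distance to the kernel; this is what Fubini's theorem is for. *)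
Lemma avg2_swap (F : R -> R -> R) : bmeas2 F -> (forall x y, 0 <= F x y) ->
  avg2 (fun x y => F y x) = avg2 F.
Proof.
move=> bF F0.
pose h (z : R * R) : \bar R := (F z.1 z.2 * (\1_I01 z.1 * \1_I01 z.2))%:E.
have bFs : bmeas2 (fun x y => F y x).
  apply: (@bmeas_comp _ _ _ _ _ (fun z : R * R => F z.1 z.2) (fun z => (z.2, z.1))) => //.
  exact: measurable_fun_pair.
have mh : measurable_fun setT h.
  apply/measurable_EFinP; apply: measurable_funM; first by case: bF.
  by apply: measurable_funM; apply: measurableT_comp => //; exact: measurable_indic.
have h0 z : (0 <= h z)%E by rewrite lee_fin !mulr_ge0// indicE.
have avgE (G : R -> R) : bmeas G -> (avg G)%:E = (\int[mu]_(x in I01) (G x)%:E)%E.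
  by move=> bG; rewrite fineK//; exact: (integrable_fin_num _ (integrable_bmeas bG)).
have := @fubini_tonelli _ _ _ _ R mu mu h mh h0.
rewrite /fubini_F /fubini_G /h/= => FT.
apply/EFin_inj; rewrite !avgE; [|exact: bmeas2_avg..].
transitivity (\int[mu]_y \int[mu]_x (F x y * (\1_I01 x * \1_I01 y))%:E)%E; last first.
  rewrite -FT [RHS]integral_mkcond; apply: eq_integral => x _; rewrite patchE.
  case: ifPn => xI; last first.
    rewrite integral0_eq; [exact: erefl|move=> y _]; rewrite [\1_I01 x]indicE (negbTE xI) mul0r mulr0; exact: erefl.
  rewrite avgE; last exact: bmeas2_row.
  rewrite [RHS]integral_mkcond; apply: eq_integral => y _; rewrite patchE !indicE xI mul1r.
  by case: (y \in I01); [rewrite mulr1|rewrite mulr0].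
rewrite [LHS]integral_mkcond; apply: eq_integral => y _; rewrite patchE.
case: ifPn => yI; last first.
  rewrite integral0_eq; [exact: erefl|move=> x _]; rewrite [\1_I01 y]indicE (negbTE yI) !mulr0; exact: erefl.
rewrite avgE; last exact: (bmeas2_row y bFs).
rewrite [LHS]integral_mkcond; apply: eq_integral => x _; rewrite patchE !indicE yI mulr1.
by case: (x \in I01); [rewrite mulr1|rewrite mulr0].
Qed.

Definition avg3 (F : R -> R -> R -> R) : R := avg (fun x => avg2 (F x)).

Definition bmeas3 (F : R -> R -> R -> R) : Prop :=
  bmeas (fun z : R * R * R => F z.1.1 z.1.2 z.2).

Lemma bmeas3_row F x : bmeas3 F -> bmeas2 (F x).
Proof.
move=> bF; apply: (@bmeas_comp _ _ _ _ _ (fun z : R * R * R => F z.1.1 z.1.2 z.2)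
  (fun z : R * R => (x, z.1, z.2))) => //.
by apply: measurable_fun_pair => //; exact: measurable_fun_pair.
Qed.

Lemma bmeas3_avg2 F : bmeas3 F -> bmeas (fun x => avg2 (F x)).
Proof.
by move=> bF; apply: (@bmeas2_avg _ (fun x y => avg (F x y))); exact: (bmeas_avg bF).
Qed.

Lemma bmeas3D F G : bmeas3 F -> bmeas3 G -> bmeas3 (fun x y z => F x y z + G x y z).
Proof. exact: bmeasD. Qed.

Lemma bmeas3M F G : bmeas3 F -> bmeas3 G -> bmeas3 (fun x y z => F x y z * G x y z).
Proof. exact: bmeasM. Qed.

Lemma avg3D F G : bmeas3 F -> bmeas3 G ->
  avg3 (fun x y z => F x y z + G x y z) = avg3 F + avg3 G.
Proof.
move=> bF bG; rewrite /avg3 -avgD; [|exact: bmeas3_avg2..].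
by congr avg; apply/funext => x; rewrite avg2D//; exact: bmeas3_row.
Qed.

Lemma le_avg3 F G : bmeas3 F -> bmeas3 G ->
  (forall x y z, I01 x -> I01 y -> I01 z -> F x y z <= G x y z) -> avg3 F <= avg3 G.
Proof.
move=> bF bG FG; apply: le_avg => [||x xI]; [exact: bmeas3_avg2..|].
by apply: le_avg2 => [||y z yI zI]; [exact: bmeas3_row..|exact: FG].
Qed.

Lemma bmeas3_cst c : bmeas3 (fun _ _ _ => c).
Proof. exact: bmeas_cst. Qed.

Lemma avg3_cst c : avg3 (fun _ _ _ => c) = c.
Proof. by rewrite /avg3; under eq_fun do rewrite avg2_cst; rewrite avg_cst. Qed.

Lemma bmeas3_12 f : bmeas2 f -> bmeas3 (fun x y _ => f x y).
Proof.
move=> bf; apply: (@bmeas_comp _ _ _ _ _ (fun z : R * R => f z.1 z.2)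
  (fun z : R * R * R => z.1)) => //.
exact: measurable_fst.
Qed.

Lemma bmeas3_23 f : bmeas2 f -> bmeas3 (fun _ y z => f y z).
Proof.
move=> bf; apply: (@bmeas_comp _ _ _ _ _ (fun z : R * R => f z.1 z.2)
  (fun z : R * R * R => (z.1.2, z.2))) => //.
by apply: measurable_fun_pair => //; exact: measurableT_comp.
Qed.

Lemma bmeas3_13 f : bmeas2 f -> bmeas3 (fun x _ z => f x z).
Proof.
move=> bf; apply: (@bmeas_comp _ _ _ _ _ (fun z : R * R => f z.1 z.2)
  (fun z : R * R * R => (z.1.1, z.2))) => //.
by apply: measurable_fun_pair => //; exact: measurableT_comp.
Qed.

Lemma bmeas3_tri f : bmeas2 f -> bmeas3 (fun x y z => f x y * f y z * f x z).
Proof.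
move=> bf; exact: bmeas3M (bmeas3M (bmeas3_12 bf) (bmeas3_23 bf)) (bmeas3_13 bf).
Qed.

Lemma avg3_pairs f : bmeas2 f ->
  avg3 (fun x y z => f x y + f y z + f x z) = 3 * avg2 f.
Proof.
move=> bf.
have b12 := bmeas3_12 bf; have b23 := bmeas3_23 bf; have b13 := bmeas3_13 bf.
rewrite (avg3D (bmeas3D b12 b23) b13) (avg3D b12 b23).
have -> : avg3 (fun x y _ => f x y) = avg2 f.
  by rewrite /avg3 /avg2; congr avg; apply/funext => x; congr avg; apply/funext => y; exact: avg_cst.
have -> : avg3 (fun _ y z => f y z) = avg2 f by exact: avg_cst.
have -> : avg3 (fun x _ z => f x z) = avg2 f.
  by rewrite /avg3 /avg2; congr avg; apply/funext => x; exact: avg_cst.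
ring.
Qed.

Lemma edge_densityE f : edge_density f = avg2 f.
Proof. by []. Qed.

Lemma triangle_densityE f : triangle_density f = avg3 (fun x y z => f x y * f y z * f x z).
Proof. by []. Qed.

Lemma entropyE r f : entropy r f = avg2 (fun x y => entropy_fun r (f x y)).
Proof. by []. Qed.

Lemma eq_triangle_density f g : (forall x y, I01 x -> I01 y -> f x y = g x y) ->
  triangle_density f = triangle_density g.
Proof.
move=> fg; rewrite !triangle_densityE; apply: eq_avg => x /set_mem xI.
by apply: eq_avg2 => y z yI zI; rewrite !fg.
Qed.

(** Exchange [f] for [g] in one factor at a time. *)
Lemma triangle_density_lip_le f g :
  bmeas2 f -> bmeas2 g -> (forall x y, 0 <= f x y <= 1) -> (forall x y, 0 <= g x y <= 1) ->
  triangle_density f <= triangle_density g + 3 * avg2 (fun x y => `|f x y - g x y|).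
Proof.
move=> bf bg f01 g01; have bd := bmeas2_dist bf bg.
have bd3 : bmeas3 (fun x y z => `|f x y - g x y| + `|f y z - g y z| + `|f x z - g x z|).
  exact: bmeas3D (bmeas3D (bmeas3_12 bd) (bmeas3_23 bd)) (bmeas3_13 bd).
rewrite !triangle_densityE -(avg3_pairs bd) -(avg3D (bmeas3_tri bg) bd3).
apply: le_avg3 => [||x y z _ _ _]; first exact: bmeas3_tri.
  exact: bmeas3D (bmeas3_tri bg) bd3.
have /andP[a0 a1] := f01 x y; have /andP[b0 b1] := f01 y z; have /andP[c0 c1] := f01 x z.
have /andP[a0' a1'] := g01 x y; have /andP[b0' b1'] := g01 y z; have /andP[c0' c1'] := g01 x z.
have -> : f x y * f y z * f x z = g x y * g y z * g x z + ((f x y - g x y) * (f y z * f x z)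
   + (f y z - g y z) * (g x y * f x z) + (f x z - g x z) * (g x y * g y z)) by ring.
have le1 (u v w : R) : 0 <= v -> v <= 1 -> 0 <= w -> w <= 1 -> u * (v * w) <= `|u|.
  move=> v0 v1 w0 w1; rewrite (le_trans (ler_norm _))// normrM ler_piMr//.
  by rewrite ger0_norm ?mulr_ge0// mulr_ile1.
by rewrite lerD2l !lerD// le1.
Qed.

Lemma triangle_density_lip f g :
  bmeas2 f -> bmeas2 g -> (forall x y, 0 <= f x y <= 1) -> (forall x y, 0 <= g x y <= 1) ->
  `|triangle_density f - triangle_density g| <= 3 * avg2 (fun x y => `|f x y - g x y|).
Proof.
move=> bf bg f01 g01; have := triangle_density_lip_le bf bg f01 g01.
have := triangle_density_lip_le bg bf g01 f01.
have -> : (fun x y => `|g x y - f x y|) = (fun x y => `|f x y - g x y|).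
  by apply/funext => x; apply/funext => y; exact: distrC.
move: (triangle_density f) (triangle_density g) (avg2 _) => a b d.
by rewrite ler_norml; lra.
Qed.

Lemma avg3_label (L : finType) (s : R -> L) (G : L -> L -> L -> R) : measurable_label s ->
  avg3 (fun x y z => G (s x) (s y) (s z)) = wsum3 (freq s) G.
Proof.
move=> ls; rewrite /avg3 /wsum3 /wsum -(avg_label (fun k => wsum2 (freq s) (G k)) ls).
by congr avg; apply/funext => x; exact: avg2_label.
Qed.

End TripleAverages.

(** * The entropy function *)

Section EntropyModulus.
Context {R : realType}.
Implicit Types u v w eps : R.

Lemma ln_leB1 u : 0 < u -> ln u <= u - 1.
Proof. by move=> u0; have := @le_ln1Dx R (u - 1); rewrite addrCA subrr addr0; apply; lra. Qed.

Lemma eta0 : eta (0 : R) = 0.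
Proof. by rewrite /eta mul0r. Qed.

Lemma eta_le0 u : 0 <= u <= 1 -> eta u <= 0.
Proof. by move=> /andP[u0 u1]; rewrite /eta mulr_ge0_le0// ln_le0. Qed.

(** From [ln x <= x - 1] at [x = eps / w] and at [x = 1 / eps]. *)
Lemma eta_lower eps w : 0 < eps -> 0 <= w -> - eta w <= eps + eps^-1 * w.
Proof.
move=> e0; rewrite le_eqVlt => /predU1P[<-|w0]; first by rewrite eta0 mulr0; lra.
have h1 : ln (eps / w) <= eps / w - 1 by rewrite ln_leB1// divr_gt0.
have h2 : ln eps^-1 <= eps^-1 - 1 by rewrite ln_leB1// invr_gt0.
rewrite ln_div ?posrE// in h1; rewrite lnV ?posrE// in h2.
have {}h1 : w * (ln eps - ln w) <= w * (eps / w - 1) by rewrite ler_wpM2l// ltW.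
have {}h2 : w * - ln eps <= w * (eps^-1 - 1) by rewrite ler_wpM2l// ltW.
have ew : w * (eps / w) = eps by rewrite mulrC divfK// gt_eqF.
rewrite /eta; lra.
Qed.

Lemma eta_superadd v w : 0 <= v -> 0 <= w -> eta v + eta w <= eta (v + w).
Proof.
move=> v0 w0; rewrite /eta mulrDl.
have h (x y : R) : 0 <= x -> 0 <= y -> x * ln x <= x * ln (x + y).
  rewrite le_eqVlt => /predU1P[<-|x0] y0; first by rewrite !mul0r.
  by rewrite ler_wpM2l ?(ltW x0)// ler_ln ?posrE; lra.
by apply: lerD; [exact: h|rewrite addrC; exact: h].
Qed.

Lemma eta_increment v w : 0 <= v -> 0 <= w -> v + w <= 1 -> eta (v + w) - eta v <= w.
Proof.
move=> v0 w0 vw1; have l : ln (v + w) <= 0 by exact: ln_le0.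
move: v0; rewrite le_eqVlt => /predU1P[v0|v0].
  by rewrite -v0 add0r eta0 subr0 (le_trans (eta_le0 _))//; lra.
have := @ln_leB1 ((v + w) / v) _; rewrite divr_gt0//; last by lra.
rewrite ln_div ?posrE; [|lra|lra] => /(_ isT) h.
have {}h : v * (ln (v + w) - ln v) <= v * ((v + w) / v - 1) by rewrite ler_wpM2l// ltW.
have vv : v * ((v + w) / v) = v + w by rewrite mulrC divfK// gt_eqF.
have := mulr_ge0_le0 w0 l; rewrite /eta; lra.
Qed.

(** The derivative of [eta] is unbounded at [0], so that there is no Lipschitz
    bound; but [eta] is superadditive, which reduces the modulus of continuity to
    the behaviour at [0], where [eta_lower] applies. *)
Lemma eta_modulus eps u v : 0 < eps -> 0 <= u <= 1 -> 0 <= v <= 1 ->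
  `|eta u - eta v| <= eps + (1 + eps^-1) * `|u - v|.
Proof.
move=> e0; wlog vu : u v / v <= u => [H u01 v01|/andP[u0 u1] /andP[v0 v1]].
  have [vu|/ltW uv] := leP v u; first exact: H.
  by rewrite distrC [`|u - v|]distrC; exact: H.
have w0 : 0 <= u - v by lra.
have h1 := eta_lower e0 w0; have h2 := eta_superadd v0 w0.
have h3 := @eta_increment v (u - v) v0 w0; rewrite [v + (u - v)]addrC subrK in h3; have {}h3 := h3 u1.
rewrite [v + (u - v)]addrC subrK in h2.
have ei : 0 <= eps^-1 * (u - v) by rewrite mulr_ge0// invr_ge0 ltW.
rewrite (ger0_norm w0) ler_norml; lra.
Qed.

Lemma neg_entropy_fun_modulus eps u v : 0 < eps -> 0 <= u <= 1 -> 0 <= v <= 1 ->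
  `|neg_entropy_fun u - neg_entropy_fun v| <= eps + (1 + eps^-1) * `|u - v|.
Proof.
move=> e0 u01 v01; have h1 := eta_modulus e0 u01 v01.
have := @eta_modulus eps (1 - u) (1 - v) e0 _ _.
have -> : 1 - u - (1 - v) = - (u - v) by ring.
rewrite normrN => /(_ _ _) h2; have {}h2 := h2 ltac:(lra) ltac:(lra).
have -> : neg_entropy_fun u - neg_entropy_fun v =
  2^-1 * (eta u - eta v) + 2^-1 * (eta (1 - u) - eta (1 - v)) by rewrite /neg_entropy_fun; ring.
rewrite (le_trans (ler_normD _ _))// !normrM ger0_norm ?invr_ge0//; lra.
Qed.

Lemma neg_entropy_fun_bound u : 0 <= u <= 1 -> `|neg_entropy_fun u| <= 3.
Proof.
have ep1 : neg_entropy_fun (1 : R) = 0.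
  by rewrite /neg_entropy_fun subrr eta0 /eta ln1 mulr0 addr0 mulr0.
move=> u01; have := @neg_entropy_fun_modulus 1 u 1 ltr01 u01; rewrite ep1 subr0 invr1 => h.
have {}h := h ltac:(lra); rewrite (le_trans h)//.
have : `|u - 1| <= 1 by rewrite ler_norml; lra.
lra.
Qed.

(** Relative entropies for different reference probabilities differ by an affine
    function only, which is how those for [p] and [q] will be compared. *)
Lemma entropy_funE r u : 0 < r < 1 -> 0 <= u <= 1 ->
  entropy_fun r u = neg_entropy_fun u - 2^-1 * ln (r / (1 - r)) * u - 2^-1 * ln (1 - r).
Proof.
move=> /andP[r0 r1] /andP[u0 u1]; rewrite /entropy_fun /neg_entropy_fun /eta.
have h (x s : R) : 0 <= x -> 0 < s -> x * ln (x / s) = x * ln x - x * ln s.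
  rewrite le_eqVlt => /predU1P[<-|x0] s0; first by rewrite !mul0r subr0.
  by rewrite ln_div ?posrE// mulrBr.
rewrite !h ?ln_div ?posrE; [ring|lra..].
Qed.

End EntropyModulus.

(** * Symmetric kernels *)

Section Kernels.
Context {R : realType}.
Local Notation I01 := (`[0, 1]%classic : set R).
Implicit Types f g : R -> R -> R.

(** A graphon representative that is tame on the whole plane, not only on the
    unit square. *)
Definition kernel f : Prop :=
  [/\ bmeas2 f, forall x y, 0 <= f x y <= 1 & forall x y, f x y = f y x].

Lemma kernel_graphons f : kernel f -> graphons f.
Proof.
move=> [[mf _] f01 fsym]; split => [|x y _ _|x y _ _]; [|exact: fsym|exact: f01].
exact: measurable_funTS.
Qed.

(** Replace the values outside of the unit square by zero. *)
Lemma graphons_kernel f : graphons f ->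
  exists2 g, kernel g & forall x y, I01 x -> I01 y -> f x y = g x y.
Proof.
move=> [mf fsym f01].
pose g x y := ((fun z : R * R => f z.1 z.2) \_ (I01 `*` I01)) (x, y).
have gE x y : g x y = if (x \in I01) && (y \in I01) then f x y else 0.
  by rewrite /g patchE in_setX.
have g01 x y : 0 <= g x y <= 1.
  rewrite gE; case: ifPn => [/andP[xI yI]|_]; last by rewrite lexx ler01.
  exact: f01.
exists g; last by move=> x y xI yI; rewrite gE !mem_set.
split => //.
  split; last by exists 1 => z; have := g01 z.1 z.2; rewrite ler_norml; lra.
  have := (measurable_restrictT (fun z : R * R => f z.1 z.2)
    (measurableX (measurable_itv _) (measurable_itv _))).1 mf.
  by apply: eq_measurable_fun => z _; rewrite /g -surjective_pairing.
move=> x y; rewrite !gE andbC; case: ifP => // /andP[yI xI].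
exact: fsym.
Qed.

Lemma kernel_cst c : 0 <= c <= 1 -> kernel (fun _ _ => c).
Proof. by move=> c01; split => //; exact: bmeas2_cst. Qed.

Lemma kernel_mix f c s : kernel f -> 0 <= c <= 1 -> 0 <= s <= 1 ->
  kernel (fun x y => (1 - s) * f x y + s * c).
Proof.
move=> [bf f01 fsym] c01 s01; split => [|x y|x y]; last by rewrite fsym.
- apply: bmeas2D; last exact: bmeas2_cst.
  exact: bmeas2Z.
- by have := f01 x y; nra.
Qed.

Lemma kernel_label (L : finType) (s : R -> L) (a : L -> L -> R) :
  measurable_label s -> (forall k l, a k l = a l k) -> (forall k l, 0 <= a k l <= 1) ->
  kernel (fun x y => a (s x) (s y)).
Proof. by move=> ls asym a01; split => //; exact: bmeas2_label. Qed.

Lemma bmeas2_comp_cont (h : R -> R) f (M : R) : measurable_fun setT h ->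
  (forall u, 0 <= u <= 1 -> `|h u| <= M) -> kernel f -> bmeas2 (fun x y => h (f x y)).
Proof.
move=> mh hM [[mf _] f01 _]; split; first exact: measurableT_comp mh mf.
by exists M => z; exact: hM.
Qed.

Lemma measurable_eta : measurable_fun setT (@eta R).
Proof. by apply: measurable_funM => //; exact: measurable_ln. Qed.

Lemma measurable_neg_entropy_fun : measurable_fun setT (@neg_entropy_fun R).
Proof.
apply: measurable_funM => //; apply: measurable_funD; first exact: measurable_eta.
apply: measurableT_comp; first exact: measurable_eta.
exact: measurable_funB.
Qed.

Lemma bmeas2_neg_entropy_fun f : kernel f -> bmeas2 (fun x y => neg_entropy_fun (f x y)).
Proof. exact: bmeas2_comp_cont measurable_neg_entropy_fun neg_entropy_fun_bound. Qed.

Definition neg_entropy f : R := avg2 (fun x y => neg_entropy_fun (f x y)).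

Lemma entropy_neg_entropy r f : 0 < r < 1 -> kernel f ->
  entropy r f = neg_entropy f - 2^-1 * ln (r / (1 - r)) * edge_density f - 2^-1 * ln (1 - r).
Proof.
move=> r01 kf; have [bf f01 _] := kf; rewrite entropyE edge_densityE.
rewrite (_ : (fun x y => _) = fun x y => neg_entropy_fun (f x y)
  - 2^-1 * ln (r / (1 - r)) * f x y - 2^-1 * ln (1 - r)); last first.
  by apply/funext => x; apply/funext => y; rewrite entropy_funE.
have bs := bmeas2_neg_entropy_fun kf; have bz := bmeas2Z (2^-1 * ln (r / (1 - r))) bf.
by rewrite (avg2B (bmeas2B bs bz) (bmeas2_cst _)) (avg2B bs bz) avg2Z// avg2_cst.
Qed.

Lemma neg_entropy_modulus eps f g : 0 < eps -> kernel f -> kernel g ->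
  `|neg_entropy f - neg_entropy g| <= eps + (1 + eps^-1) * avg2 (fun x y => `|f x y - g x y|).
Proof.
move=> e0 kf kg; have [bf f01 _] := kf; have [bg g01 _] := kg.
have bsf := bmeas2_neg_entropy_fun kf; have bsg := bmeas2_neg_entropy_fun kg.
rewrite /neg_entropy -avg2B// (le_trans (le_norm_avg2 _))//; first exact: bmeas2B.
have bd := bmeas2Z (1 + eps^-1) (bmeas2_dist bf bg).
rewrite -avg2Z; last exact: bmeas2_dist.
rewrite -[X in X + _](avg2_cst (R := R)) -avg2D//; last exact: bmeas2_cst.
apply: le_avg2 => [||x y _ _].
- exact: bmeas2_dist.
- exact: bmeas2D (bmeas2_cst _) bd.
- exact: neg_entropy_fun_modulus.
Qed.

Definition clip u : R := Num.max 0 (Num.min 1 u).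

Lemma clip01 u : 0 <= clip u <= 1.
Proof. by rewrite /clip le_max lexx/= ge_max ler01 ge_min lexx. Qed.

Lemma clip_dist u v : 0 <= u <= 1 -> `|u - clip v| <= `|u - v|.
Proof.
move=> /andP[u0 u1]; rewrite /clip /Num.min /Num.max.
have [v1|v1] := ltP 1 v; first by rewrite ltr01 !ler0_norm; lra.
have [v0|v0] := ltP 0 v => //.
by rewrite subr0 !ger0_norm; lra.
Qed.

(** A step kernel close to [f] may be neither symmetric nor [[0, 1]]-valued, but
    symmetrising and clipping it does not increase its distance to [f]. *)
Lemma kernel_step_approx f eps : kernel f -> 0 < eps ->
  exists (L : finType) (s : R -> L) (a : L -> L -> R),
    [/\ measurable_label s, forall k l, a k l = a l k, forall k l, 0 <= a k l <= 1 &
        avg2 (fun x y => `|f x y - a (s x) (s y)|) <= eps].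
Proof.
move=> kf e0; have [bf f01 fsym] := kf.
have [L [s [a [ls sa]]]] := step_approximable_bmeas bf f01 e0.
exists L, s, (fun k l => clip (2^-1 * a k l + 2^-1 * a l k)); split; [exact: ls| | |].
- by move=> k l; rewrite addrC.
- by move=> k l; exact: clip01.
have ba : bmeas2 (fun x y => a (s x) (s y)) by exact: bmeas2_label.
have bat : bmeas2 (fun x y => a (s y) (s x)) by exact: (bmeas2_label (fun k l => a l k)).
have bd := bmeas2_dist bf ba; have bdt := bmeas2_dist bf bat.
have sat : avg2 (fun x y => `|f x y - a (s y) (s x)|) <= eps.
  apply: le_trans sa; rewrite -(avg2_swap bd)// le_eqVlt; apply/orP; left; apply/eqP.
  by apply: eq_avg2 => x y _ _; rewrite fsym.
apply: (@le_trans _ _ (avg2 (fun x y => 2^-1 * `|f x y - a (s x) (s y)| + 2^-1 * `|f x y - a (s y) (s x)|))).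
  apply: le_avg2 => [||x y _ _].
  - apply: bmeas2_dist => //.
    exact: (bmeas2_label (fun k l => clip (2^-1 * a k l + 2^-1 * a l k))).
  - exact: bmeas2D (bmeas2Z _ bd) (bmeas2Z _ bdt).
  rewrite (le_trans (clip_dist _ (f01 x y)))//.
  have -> : f x y - (2^-1 * a (s x) (s y) + 2^-1 * a (s y) (s x)) =
    2^-1 * (f x y - a (s x) (s y)) + 2^-1 * (f x y - a (s y) (s x)) by field.
  by rewrite (le_trans (ler_normD _ _))// !normrM ger0_norm// invr_ge0.
rewrite (avg2D (bmeas2Z _ bd) (bmeas2Z _ bdt)) (avg2Z _ bd) (avg2Z _ bdt).
have h2 : 0 <= 2^-1 :> R by rewrite invr_ge0.
apply: (le_trans (lerD (ler_wpM2l h2 sa) (ler_wpM2l h2 sat))).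
by rewrite (_ : 2^-1 * eps + 2^-1 * eps = eps); [exact: lexx|field].
Qed.

End Kernels.

(** * Finite graphs as step kernels *)

Section GraphGraphons.
Context {R : realType}.

Definition cell (n i : nat) : set R := `[i%:R / n%:R, i.+1%:R / n%:R[%classic.

Lemma cell_inj n i j x : (0 < n)%N -> cell n i x -> cell n j x -> i = j.
Proof.
move=> n0; rewrite /cell /= !in_itv/= => /andP[i1 i2] /andP[j1 j2].
have N0 : 0 < n%:R :> R by rewrite ltr0n.
rewrite ler_pdivrMr// in i1; rewrite ltr_pdivlMr// in i2.
rewrite ler_pdivrMr// in j1; rewrite ltr_pdivlMr// in j2.
have := le_lt_trans i1 j2; have := le_lt_trans j1 i2; rewrite !ltr_nat; lia.
Qed.

(** The labelling that turns the graphon of a graph into a step kernel; points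
    outside of all cells, such as [1], have no label. *)
Definition owner n (x : R) : option 'I_n := [pick i : 'I_n | x \in cell n i].

Lemma owner_preimage n (i : 'I_n) : owner n @^-1` [set Some i] = cell n i.
Proof.
have n0 : (0 < n)%N by case: i => i /=; case: n.
apply/seteqP; split=> x /=; rewrite /owner; case: pickP => [j xj|xn].
- by move=> [<-]; exact: set_mem xj.
- by [].
- by move=> xi; congr Some; apply: val_inj; exact: (cell_inj n0 (set_mem xj) xi).
- by move=> xi; have := xn i; rewrite mem_set.
Qed.

Lemma measurable_label_owner n : measurable_label (owner n).
Proof.
move=> [i|]; first by rewrite owner_preimage; exact: measurable_itv.
have -> : owner n @^-1` [set None] = ~` (\bigcup_(i in [set: 'I_n]) owner n @^-1` [set Some i]).
  apply/seteqP; split=> x /=.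
    by move=> xN [i _ /=]; rewrite xN.
  case E : (owner n x) => [i|]// H; exfalso; apply: H; exists i => //.
apply/measurableC/fin_bigcup_measurable => // i _.
by rewrite owner_preimage; exact: measurable_itv.
Qed.

Definition owner_adj n (X : Omega n) (k l : option 'I_n) : R :=
  if k is Some i then (if l is Some j then adjR X i j else 0) else 0.

Lemma graphon_ofE n (X : Omega n) (x y : R) :
  graphon_of X x y = owner_adj X (owner n x) (owner n y).
Proof.
have ind (i : 'I_n) (z : R) : \1_(cell n i) z = (owner n z == Some i)%:R :> R.
  rewrite indicE -owner_preimage; congr (nat_of_bool _)%:R.
  by apply/idP/eqP => [/set_mem|zi]; [|apply/mem_set].
rewrite /graphon_of; under eq_bigr do under eq_bigr do rewrite !ind.
rewrite /owner_adj; case: (owner n x) => [i|]; last first.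
  by rewrite big1// => i _; rewrite big1// => j _; rewrite mulr0 mul0r.
rewrite (bigD1 i)//= [X in _ + X]big1 => [|i' i'i]; last first.
  rewrite big1// => j _; rewrite (_ : (Some i == Some i') = false) ?mulr0 ?mul0r//.
  by apply/eqP => -[ii]; rewrite ii eqxx in i'i.
rewrite addr0 eqxx; case: (owner n y) => [j|]; last first.
  by rewrite big1// => j _; rewrite mulr0.
rewrite (bigD1 j)//= big1 => [|j' j'j]; last first.
  rewrite (_ : (Some j == Some j') = false) ?mulr0//.
  by apply/eqP => -[jj]; rewrite jj eqxx in j'j.
by rewrite eqxx !mulr1 addr0.
Qed.

Lemma kernel_graphon_of n (X : Omega n) : kernel (graphon_of X : R -> R -> R).
Proof.
have -> : graphon_of X = fun x y => owner_adj X (owner n x) (owner n y).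
  by apply/funext => x; apply/funext => y; exact: graphon_ofE.
apply: kernel_label; first exact: measurable_label_owner.
  by move=> [i|] [j|] //=; rewrite /adjR adjC.
by move=> [i|] [j|] /=; rewrite /adjR ?lexx ?ler01//; case: (adj _ _ _); rewrite ?lexx ?ler01.
Qed.

Lemma freq_owner n (i : 'I_n) : freq (owner n) (Some i) = n%:R^-1.
Proof.
have n0 : (0 < n)%N by case: i => i /=; case: n.
have N0 : 0 < n%:R :> R by rewrite ltr0n.
rewrite /freq owner_preimage /avg /Rintegral integral_indic//; last exact: measurable_itv.
rewrite setIidl => [|x]; last first.
  rewrite /cell /= !in_itv/= => /andP[x1 x2]; rewrite (le_trans _ x1) ?divr_ge0//=.
  by rewrite (le_trans (ltW x2))// ler_pdivrMr// mul1r ler_nat.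
rewrite /cell/= lebesgue_measure_itv/= lte_fin ltr_pM2r ?invr_gt0// ltr_nat ltnSn/=.
by rewrite -mulrBl -natrB// subSnn mul1r.
Qed.

Lemma wsum_owner n (G : option 'I_n -> R) : G None = 0 ->
  wsum (freq (owner n)) G = n%:R^-1 * \sum_(i < n) G (Some i).
Proof.
move=> G0; rewrite /wsum (bigD1 None)//= G0 mulr0 add0r.
rewrite (reindex_omap Some id) => [|[i|]]//=.
rewrite mulr_sumr; apply: eq_big => [i|i _]; first by rewrite eqxx.
by rewrite freq_owner.
Qed.

Lemma edge_density_graphon_of n (X : Omega n) :
  edge_density (graphon_of X) = n%:R ^- 2 * \sum_(i < n) \sum_(j < n) adjR X i j :> R.
Proof.
have -> : graphon_of X = fun x y => owner_adj X (owner n x) (owner n y).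
  by apply/funext => x; apply/funext => y; exact: graphon_ofE.
rewrite edge_densityE (avg2_label _ (@measurable_label_owner n)).
rewrite -[LHS]/(wsum2 (freq (owner n)) (owner_adj X)) /wsum2 wsum_owner; last first.
  by rewrite /wsum big1// => k _; rewrite mulr0.
rewrite expr2 invfM -[RHS]mulrA; congr (_ * _); rewrite mulr_sumr; apply: eq_bigr => i _.
by rewrite wsum_owner.
Qed.

Lemma triangle_density_graphon_of n (X : Omega n) :
  triangle_density (graphon_of X) = n%:R ^- 3 * \sum_t tri (adjR X) t :> R.
Proof.
have -> : graphon_of X = fun x y => owner_adj X (owner n x) (owner n y).
  by apply/funext => x; apply/funext => y; exact: graphon_ofE.
rewrite triangle_densityE.
rewrite (avg3_label (fun k l m => owner_adj X k l * owner_adj X l m * owner_adj X k m) (@measurable_label_owner n)).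
rewrite /wsum3 wsum_owner; last first.
  by rewrite /wsum2 /wsum big1// => k _; rewrite big1 ?mulr0// => l _; rewrite !mul0r mulr0.
rewrite exprS invfM -[RHS]mulrA sum_triples; congr (_ * _); rewrite mulr_sumr; apply: eq_bigr => i _.
rewrite /wsum2 wsum_owner; last first.
  by rewrite /wsum big1// => k _; rewrite /= !mul0r mulr0.
rewrite expr2 invfM -[RHS]mulrA; congr (_ * _); rewrite mulr_sumr; apply: eq_bigr => j _.
by rewrite wsum_owner//= mulr0.
Qed.

(** The diagonal blocks vanish. *)
Lemma triangle_density_graphon_of_lt1 n (X : Omega n) : (0 < n)%N ->
  triangle_density (graphon_of X) < (1 : R).
Proof.
move=> n0; have N0 : 0 < n%:R :> R by rewrite ltr0n.
rewrite triangle_density_graphon_of ltr_pdivrMl ?exprn_gt0// mulr1.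
have adj01 (i j : 'I_n) : 0 <= (adjR X i j : R) <= 1.
  by rewrite /adjR; case: (adj _ _ _); rewrite ?lexx ?ler01.
have tri1 t : (tri (adjR X) t : R) <= 1.
  have /andP[a0 a1] := adj01 t.1.1 t.1.2; have /andP[b0 b1] := adj01 t.1.2 t.2.
  have /andP[c0 c1] := adj01 t.1.1 t.2.
  by rewrite /tri mulr_ile1 ?mulr_ge0// mulr_ile1.
pose i0 := Ordinal n0; pose t0 := (i0, i0, i0).
rewrite (bigD1 t0)//= {1}/tri/= /adjR adjii mulr0n !mul0r add0r.
have n3 : \sum_(t : 'I_n * 'I_n * 'I_n) 1 = n%:R ^+ 3 :> R.
  by rewrite sumr_const !card_prod card_ord !natrM; ring.
rewrite -n3 [ltRHS](bigD1 t0)//=.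
by apply: ltr_pwDl => //; apply: ler_sum => t _; exact: tri1.
Qed.

(** The combinatorial content of the large deviation lower bound.  Both densities
    and the negative entropy are continuous for the L^1 distance, so [count_step]
    carries over from step kernels to their limits. *)
Lemma count_kernel (f : R -> R -> R) (eps : R) : kernel f -> 0 < eps ->
  \forall n \near \oo,
    expR (- (n%:R ^+ 2 * (neg_entropy f + eps))) <=
    \sum_(X : Omega n | (`|edge_density (graphon_of X) - edge_density f| <= eps) &&
        (`|triangle_density (graphon_of X) - triangle_density f| <= eps)) 1.
Proof.
move=> kf e0; have [bf f01 fsym] := kf.
(* [C] is chosen so that an L^1 distance of [d / C] suffices for the triangle
   density, whose Lipschitz constant is [3], and for the entropy, whose modulus
   of continuity has the slope [1 + 1 / d]. *)
pose d := eps / 8; have d0 : 0 < d by rewrite divr_gt0.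
pose C := 3 + (1 + d^-1); have C0 : 0 < C by rewrite /C !addr_gt0 ?invr_gt0.
have [L [s [a [ls asym a01 fa]]]] := kernel_step_approx kf (divr_gt0 d0 C0).
set D := avg2 _ in fa.
have CD : C * D <= d by rewrite mulrC -ler_pdivlMr.
have ka := kernel_label ls asym a01; have [ba _ _] := ka.
have D0 : 0 <= D.
  by rewrite -(avg2_cst (0 : R)); apply: le_avg2 => [||x y _ _]; [exact: bmeas2_cst|exact: bmeas2_dist|exact: normr_ge0].
have Dd : D * d^-1 >= 0 by rewrite mulr_ge0// invr_ge0 ltW.
have hE : `|edge_density f - wsum2 (freq s) a| <= d.
  rewrite -[wsum2 _ _](avg2_label a ls) edge_densityE -avg2B//.
  rewrite (le_trans (le_norm_avg2 _))//; first exact: bmeas2B.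
  by rewrite -/D; move: CD; rewrite /C; lra.
have hT : `|triangle_density f - wsum3 (freq s) (fun k l m => a k l * a l m * a k m)| <= d.
  rewrite -(avg3_label (fun k l m => a k l * a l m * a k m) ls).
  have := triangle_density_lip bf ba f01 (fun x y => a01 (s x) (s y)).
  rewrite -/D => h; apply: (le_trans h); move: CD; rewrite /C; lra.
have hH : `|neg_entropy f - wsum2 (freq s) (fun k l => neg_entropy_fun (a k l))| <= 2 * d.
  rewrite -[wsum2 _ _](avg2_label (fun k l => neg_entropy_fun (a k l)) ls).
  have := neg_entropy_modulus d0 kf ka; rewrite -/D => h; apply: (le_trans h).
  by move: CD; rewrite /C; lra.
have [N _ HN] := filterI (nbhs_infty_gt 0%N) (count_step (@freq_ge0 R L s) (freq_sum1 ls) asym a01 d0).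
exists N => // n /HN [/= n0 h]; have N0 : 0 < n%:R :> R by rewrite ltr0n.
apply: le_trans (le_trans h _).
  rewrite ler_expR lerN2 ler_pM2l ?exprn_gt0//.
  by move: hH; rewrite ler_norml /d; lra.
rewrite big_mkcond [leRHS]big_mkcond; apply: ler_sum => X _.
case: ifP => [/andP[g1 g2]|_]; last by case: ifP.
rewrite ifT// edge_density_graphon_of triangle_density_graphon_of.
have rescale m (u v w : R) : `|u - n%:R ^+ m * v| <= d * n%:R ^+ m -> `|w - v| <= d ->
    `|n%:R ^- m * u - w| <= eps.
  move=> h1 h2.
  have -> : n%:R ^- m * u - w = n%:R ^- m * (u - n%:R ^+ m * v) - (w - v).
    by rewrite mulrBr mulKf ?expf_neq0 ?gt_eqF//; ring.
  rewrite (le_trans (ler_normB _ _))// normrM gtr0_norm ?invr_gt0 ?exprn_gt0//.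
  have : n%:R ^- m * `|u - n%:R ^+ m * v| <= d by rewrite ler_pdivrMl ?exprn_gt0// [leRHS]mulrC.
  by move: h2; rewrite /d; lra.
by apply/andP; split; [exact: rescale g1 hE|exact: rescale g2 hT].
Qed.

End GraphGraphons.

(** * Mixing a kernel with a constant *)

Section Mixing.
Context {R : realType}.
Implicit Types (f g : R -> R -> R) (p q r t u v s c e : R).

(** The convex function [eta] lies above its tangent at [v]. *)
Lemma eta_tangent u v : 0 <= u -> 0 < v -> u * ln v + u - v <= eta u.
Proof.
move=> u0 v0; move: u0; rewrite le_eqVlt => /predU1P[<-|u0].
  by rewrite eta0 mul0r; lra.
have h : ln (v / u) <= v / u - 1 by rewrite ln_leB1// divr_gt0.
rewrite ln_div ?posrE// in h.
have {}h : u * (ln v - ln u) <= u * (v / u - 1) by rewrite ler_wpM2l// ltW.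
have uv : u * (v / u) = v by rewrite mulrC divfK// gt_eqF.
rewrite /eta; lra.
Qed.

Lemma eta_convex u v s : 0 <= u -> 0 <= v -> 0 <= s <= 1 ->
  eta ((1 - s) * u + s * v) <= (1 - s) * eta u + s * eta v.
Proof.
move=> u0 v0 /andP[s0 s1]; have s'0 : 0 <= 1 - s by lra.
have a0 : 0 <= (1 - s) * u by rewrite mulr_ge0.
have b0 : 0 <= s * v by rewrite mulr_ge0.
set m := _ + _; have [m0|m0] := ltP 0 m; last first.
  have a00 : (1 - s) * u = 0.
    by apply: le_anti; rewrite a0 andbT (le_trans _ m0)// /m lerDl.
  have b00 : s * v = 0.
    by apply: le_anti; rewrite b0 andbT (le_trans _ m0)// /m lerDr.
  by rewrite /m a00 b00 /eta !mulrA a00 b00 !mul0r !addr0 mul0r.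
have := ler_wpM2l s'0 (eta_tangent u0 m0); have := ler_wpM2l s0 (eta_tangent v0 m0).
have -> : eta m = (1 - s) * u * ln m + s * v * ln m by rewrite /eta -mulrDl.
by move: (ln m) => l; rewrite /m; lra.
Qed.

Lemma neg_entropy_fun_convex u v s : 0 <= u <= 1 -> 0 <= v <= 1 -> 0 <= s <= 1 ->
  neg_entropy_fun ((1 - s) * u + s * v) <= (1 - s) * neg_entropy_fun u + s * neg_entropy_fun v.
Proof.
move=> /andP[u0 u1] /andP[v0 v1] s01; rewrite /neg_entropy_fun.
have h1 := eta_convex u0 v0 s01.
have := @eta_convex (1 - u) (1 - v) s _ _ s01; rewrite !subr_ge0 => /(_ u1 v1).
have -> : (1 - s) * (1 - u) + s * (1 - v) = 1 - ((1 - s) * u + s * v) by ring.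
lra.
Qed.

Definition mix f c s x y : R := (1 - s) * f x y + s * c.

Lemma edge_density_mix f c s : kernel f ->
  edge_density (mix f c s) = (1 - s) * edge_density f + s * c.
Proof.
move=> [bf _ _]; rewrite edge_densityE.
by rewrite (avg2D (bmeas2Z (1 - s) bf) (bmeas2_cst (s * c))) avg2Z// avg2_cst.
Qed.

Lemma neg_entropy_mix f c s : kernel f -> 0 <= c <= 1 -> 0 <= s <= 1 ->
  neg_entropy (mix f c s) <= (1 - s) * neg_entropy f + s * neg_entropy_fun c.
Proof.
move=> kf c01 s01; have [_ f01 _] := kf.
have bs := bmeas2_neg_entropy_fun kf; have bm := bmeas2_neg_entropy_fun (kernel_mix kf c01 s01).
rewrite -(avg2_cst (s * neg_entropy_fun c)) /neg_entropy -avg2Z//.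
rewrite -(avg2D (bmeas2Z (1 - s) bs) (bmeas2_cst _)).
apply: le_avg2 => [||x y _ _]; first exact: bm.
  exact: bmeas2D (bmeas2Z (1 - s) bs) (bmeas2_cst _).
exact: neg_entropy_fun_convex.
Qed.

Lemma avg2_mix_dist f c s s' : kernel f -> 0 <= c <= 1 -> 0 <= s <= 1 -> 0 <= s' <= 1 ->
  avg2 (fun x y => `|mix f c s x y - mix f c s' x y|) <= `|s - s'|.
Proof.
move=> kf c01 s01 s01'; have [_ f01 _] := kf.
have [bm _ _] := kernel_mix kf c01 s01; have [bm' _ _] := kernel_mix kf c01 s01'.
rewrite -[leRHS](avg2_cst (R := R)); apply: le_avg2 => [||x y _ _].
- exact: bmeas2_dist bm bm'.
- exact: bmeas2_cst.
- have -> : mix f c s x y - mix f c s' x y = (s - s') * (c - f x y) by rewrite /mix; ring.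
  by rewrite normrM ler_piMr// ler_norml; have := f01 x y; lra.
Qed.

Lemma triangle_density_mix_dist f c s s' :
  kernel f -> 0 <= c <= 1 -> 0 <= s <= 1 -> 0 <= s' <= 1 ->
  `|triangle_density (mix f c s) - triangle_density (mix f c s')| <= 3 * `|s - s'|.
Proof.
move=> kf c01 s01 s01'.
have [bm m01 _] := kernel_mix kf c01 s01; have [bm' m01' _] := kernel_mix kf c01 s01'.
apply: (le_trans (triangle_density_lip bm bm' m01 m01')).
by rewrite ler_wpM2l//; exact: avg2_mix_dist.
Qed.

Lemma triangle_density_cst c : triangle_density (fun _ _ => c) = c ^+ 3.
Proof.
by rewrite triangle_densityE avg3_cst; ring.
Qed.

Lemma mix0 f c : mix f c 0 = f.
Proof.
by apply/funext => x; apply/funext => y; rewrite /mix subr0 mul1r mul0r addr0.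
Qed.

Lemma mix1 f c : mix f c 1 = fun _ _ => c.
Proof.
by apply/funext => x; apply/funext => y; rewrite /mix subrr mul0r mul1r add0r.
Qed.

(** Expand the product of the three mixtures: with weight [e ^ 3] all factors
    are [1], and every other term is at least the product for [f]. *)
Lemma triangle_density_mix_one f e : kernel f -> 0 <= e <= 1 ->
  triangle_density f + e ^+ 3 * (1 - triangle_density f) <= triangle_density (mix f 1 e).
Proof.
move=> kf e01; have [bf f01 _] := kf.
have [|bm m01 _] := kernel_mix kf _ e01 (c := 1); first by rewrite ler01 lexx.
have bt := bmeas3_tri bf; have bt' := bmeas3_tri bm.
rewrite !triangle_densityE.
set T := avg3 _.
have -> : T + e ^+ 3 * (1 - T) = avg3 (fun x y z => (1 - e ^+ 3) * (f x y * f y z * f x z) + e ^+ 3).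
  rewrite (avg3D (bmeas3M (bmeas3_cst (1 - e ^+ 3)) bt) (bmeas3_cst (e ^+ 3))) avg3_cst.
  have -> : avg3 (fun x y z => (1 - e ^+ 3) * (f x y * f y z * f x z)) = (1 - e ^+ 3) * T.
    rewrite /T /avg3 -avgZ; last exact: bmeas3_avg2.
    by congr avg; apply/funext => x; rewrite avg2Z//; exact: (bmeas3_row x bt).
  by ring.
apply: le_avg3 => [||x y z _ _ _]; [|exact: bt'|].
  exact: bmeas3D (bmeas3M (bmeas3_cst _) bt) (bmeas3_cst _).
have h (a b c : R) : 0 <= a <= 1 -> 0 <= b <= 1 -> 0 <= c <= 1 ->
    (1 - e ^+ 3) * (a * b * c) + e ^+ 3 <=
    ((1 - e) * a + e * 1) * ((1 - e) * b + e * 1) * ((1 - e) * c + e * 1).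
  move=> /andP[a0 a1] /andP[b0 b1] /andP[c0 c1]; have /andP[e0 e1] := e01.
  rewrite -subr_ge0.
  have e'0 : 0 <= 1 - e by lra.
  (* The difference is a multiple of [e * (1 - e)] by a factor all of whose
     terms are nonnegative. *)
  have -> : ((1 - e) * a + e * 1) * ((1 - e) * b + e * 1) * ((1 - e) * c + e * 1)
     - ((1 - e ^+ 3) * (a * b * c) + e ^+ 3) =
     e * (1 - e) * ((1 - e) * (a * b * (1 - c) + a * c * (1 - b) + b * c * (1 - a))
       + e * (a * (1 - b * c) + b * (1 - a * c) + c * (1 - a * b))) by ring.
  have le1 (u v : R) : 0 <= u -> u <= 1 -> 0 <= v -> v <= 1 -> 0 <= 1 - u * v.
    by move=> u0 u1 v0 v1; rewrite subr_ge0 mulr_ile1.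
  have ge0 (u : R) : u <= 1 -> 0 <= 1 - u by rewrite subr_ge0.
  by do ?[exact: ge0|exact: le1|exact: mulr_ge0|apply: mulr_ge0|apply: addr_ge0].
by rewrite /mix; exact: h.
Qed.

Lemma entropy_fun_ge0 r u : 0 < r < 1 -> 0 <= u <= 1 -> 0 <= entropy_fun r u.
Proof.
move=> r01 u01; rewrite entropy_funE//; have /andP[r0 r1] := r01; have /andP[u0 u1] := u01.
have r'0 : 0 < 1 - r by lra.
have u'0 : 0 <= 1 - u by lra.
have h1 := eta_tangent u0 r0; have h2 := eta_tangent u'0 r'0.
rewrite /neg_entropy_fun ln_div ?posrE//; lra.
Qed.

Lemma entropy_ge0 r f : 0 < r < 1 -> graphons f -> 0 <= entropy r f.
Proof.
move=> r01 [_ _ f01]; rewrite entropyE; apply: Rintegral_ge0 => x xI.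
apply: Rintegral_ge0 => y yI; apply: entropy_fun_ge0 => //.
by apply: f01; apply/mem_set.
Qed.

Lemma entropy_fun_self r : 0 < r < 1 -> entropy_fun r r = 0.
Proof.
move=> /andP[r0 r1]; rewrite /entropy_fun !divff ?gt_eqF//; last by lra.
by rewrite ln1 !mulr0 addr0 mulr0.
Qed.

Lemma entropy_mix r f s : 0 < r < 1 -> kernel f -> 0 <= s <= 1 ->
  entropy r (mix f r s) <= entropy r f.
Proof.
move=> r01 kf s01; have /andP[r0 r1] := r01; have /andP[s0 s1] := s01.
have r01' : 0 <= r <= 1 by lra.
have f0 := entropy_ge0 r01 (kernel_graphons kf).
rewrite entropy_neg_entropy//; last exact: kernel_mix.
rewrite edge_density_mix//; have := neg_entropy_mix kf r01' s01.
have := entropy_fun_self r01; rewrite entropy_funE// => z.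
have := mulr_ge0 s0 f0.
rewrite (entropy_neg_entropy r01 kf) => g.
have {}z : s * (neg_entropy_fun r - 2^-1 * ln (r / (1 - r)) * r - 2^-1 * ln (1 - r)) = 0.
  by rewrite z mulr0.
move: g z; move: (neg_entropy _) (neg_entropy _) (edge_density _) => a b c; lra.
Qed.

Lemma clip_lip u v : `|clip u - clip v| <= `|u - v|.
Proof.
wlog uv : u v / u <= v => [H|].
  by have [/H//|/ltW/H] := leP u v; rewrite distrC [`|v - u|]distrC.
rewrite [leRHS]ler0_norm ?subr_le0// /clip /Num.min /Num.max.
have [u1|u1] := ltP 1 u; have [v1|v1] := ltP 1 v; rewrite ?ltr01;
  have [u0|u0] := ltP 0 u; have [v0|v0] := ltP 0 v; rewrite ler_norml; lra.
Qed.

(** Moving [f] towards the constant [r], the minimizer of the relative entropy,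
    lowers the entropy by convexity.  By the intermediate value theorem the
    triangle density equals [t ^ 3] somewhere on the way. *)
Lemma entropy_at_threshold r t f : 0 < r < 1 -> r < t -> kernel f -> t ^+ 3 <= triangle_density f ->
  exists f0, [/\ kernel f0, triangle_density f0 = t ^+ 3 & entropy r f0 <= entropy r f].
Proof.
move=> r01 rt kf tf; have /andP[r0 r1] := r01.
have r01' : 0 <= r <= 1 by lra.
pose h s := triangle_density (mix f r (clip s)).
have hc : continuous h.
  move=> x; apply/cvgrPdist_le => e e0; near=> y.
  apply: (le_trans (triangle_density_mix_dist kf r01' (clip01 x) (clip01 y))).
  rewrite -ler_pdivlMl//; apply: (le_trans (clip_lip x y)).
  near: y; apply: cvgr_dist_le; first exact: cvg_id.
  by rewrite mulr_gt0// invr_gt0.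
have [||s sI hs] := @IVT R h 0 1 (t ^+ 3) ler01.
- exact: continuous_subspaceT.
- have -> : h 0 = triangle_density f.
    by rewrite /h (_ : clip 0 = 0) ?mix0// /clip min_r// maxxx.
  have -> : h 1 = r ^+ 3.
    by rewrite /h (_ : clip 1 = 1) ?mix1 ?triangle_density_cst// /clip minxx max_r.
  rewrite ge_min le_max tf orTb andbT; apply/orP; right.
  by rewrite lerXn2r ?nnegrE; lra.
exists (mix f r (clip s)); split; [|exact: hs|].
  by apply: kernel_mix; [exact: kf|exact: r01'|exact: clip01].
by apply: entropy_mix; [exact: r01|exact: kf|exact: clip01].
Unshelve. all: by end_near. Qed.

End Mixing.

(** * Lower bounds of Laplace type *)

Section Laplace.
Context {R : realType}.
Implicit Types (f g : R -> R -> R) (p q t h beta alpha : R).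

(** After division by [a] this compares [y `^ alpha] with [y] on both sides of
    [1]; it holds because [alpha <= 1]. *)
Lemma powR_lip alpha (a x : R) : 0 <= alpha <= 1 -> 0 < a -> 0 <= x ->
  `|x `^ alpha - a `^ alpha| <= a `^ alpha / a * `|x - a|.
Proof.
move=> /andP[al0 al1] a0 x0.
pose y := x / a; have y0 : 0 <= y by rewrite divr_ge0// ltW.
have xE : x = a * y by rewrite /y mulrC divfK// gt_eqF.
have yb : `|y `^ alpha - 1| <= `|y - 1|.
  have [y1|y1] := leP 1 y.
    have l1 : 1 `^ alpha <= y `^ alpha.
      by apply: (@ge0_ler_powR R alpha al0 1 y); rewrite ?nnegrE.
    rewrite powR1 in l1.
    by rewrite !ger0_norm ?subr_ge0// lerD2r ler1_powR.
  have l1 : y `^ alpha <= 1 `^ alpha.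
    by apply: (@ge0_ler_powR R alpha al0 y 1); rewrite ?nnegrE//; exact: ltW.
  rewrite powR1 in l1.
  have l2 : y <= y `^ alpha.
    move: y0; rewrite le_eqVlt => /predU1P[<-|y0]; first exact: powR_ge0.
    by rewrite ger1_powR// y0 ltW.
  have y1' : y - 1 <= 0 by rewrite subr_le0 ltW.
  have l1' : y `^ alpha - 1 <= 0 by rewrite subr_le0.
  by rewrite (ler0_norm y1') (ler0_norm l1') lerN2 lerD2r.
have -> : x `^ alpha - a `^ alpha = a `^ alpha * (y `^ alpha - 1).
  by rewrite {1}xE powRM// ?(ltW a0)// mulrBr mulr1.
have -> : x - a = a * (y - 1) by rewrite {1}xE mulrBr mulr1.
rewrite !normrM (ger0_norm (powR_ge0 _ _)) (gtr0_norm a0) mulrA divfK ?gt_eqF//.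
by rewrite ler_wpM2l// powR_ge0.
Qed.

(** For [a = 0] the value [a `^ alpha] is the least possible one. *)
Lemma powR_lower alpha (a eps : R) : 0 <= alpha <= 1 -> 0 <= a -> 0 < eps ->
  exists2 d, 0 < d & forall x, 0 <= x -> `|x - a| <= d -> a `^ alpha - eps <= x `^ alpha.
Proof.
move=> al01 a0 e0; move: a0; rewrite le_eqVlt => /predU1P[<-|a0].
  exists 1 => // x x0 _; apply: (@le_trans _ _ (0 `^ alpha)); first by rewrite gerBl ltW.
  have /andP[al0 _] := al01.
  by apply: (@ge0_ler_powR R alpha al0 0 x); rewrite ?nnegrE.
have K0 : 0 < a `^ alpha / a by rewrite divr_gt0// powR_gt0.
exists (eps / (a `^ alpha / a)); first by rewrite divr_gt0.
move=> x x0; rewrite ler_pdivlMr// mulrC => xa.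
have := le_trans (powR_lip al01 a0 x0) xa; rewrite ler_norml; lra.
Qed.

Lemma triangle_density01 f : kernel f -> 0 <= triangle_density f <= 1.
Proof.
move=> [bf f01 _]; have bt := bmeas3_tri bf.
have ff01 x y z : 0 <= f x y * f y z * f x z <= 1.
  have /andP[a0 a1] := f01 x y; have /andP[b0 b1] := f01 y z; have /andP[c0 c1] := f01 x z.
  by rewrite !mulr_ge0//= mulr_ile1 ?mulr_ge0// mulr_ile1.
rewrite triangle_densityE; apply/andP; split.
  rewrite -[leLHS]avg3_cst; apply: le_avg3 => [||x y z _ _ _]; [exact: bmeas3_cst|exact: bt|].
  by case/andP: (ff01 x y z).
rewrite -[leRHS]avg3_cst; apply: le_avg3 => [||x y z _ _ _]; [exact: bt|exact: bmeas3_cst|].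
by case/andP: (ff01 x y z).
Qed.

(** The graphs close to [f] alone already contribute
    [exp (n^2 (c - neg_entropy f))] to the sum. *)
Lemma laplace_lower f (V : forall n, Omega n -> R) (c eps d : R) :
  kernel f -> 0 < eps -> 0 < d -> (forall n X, 0 <= V n X) ->
  (forall n X, `|edge_density (graphon_of X) - edge_density f| <= d ->
     `|triangle_density (graphon_of X) - triangle_density f| <= d ->
     expR (n%:R ^+ 2 * c) <= V n X) ->
  \forall n \near \oo, expR (n%:R ^+ 2 * (c - neg_entropy f - eps)) <= \sum_X V n X.
Proof.
move=> kf e0 d0 V0 VP; have m0 : 0 < Num.min eps d by rewrite lt_min e0.
have [N _ HN] := count_kernel kf m0; exists N => // n /HN /= {}HN.
apply: (@le_trans _ _ (expR (n%:R ^+ 2 * c) * expR (- (n%:R ^+ 2 * (neg_entropy f + Num.min eps d))))).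
  rewrite -expRD ler_expR -mulrN -mulrDr ler_wpM2l ?exprn_ge0//.
  have : Num.min eps d <= eps by rewrite ge_min lexx.
  lra.
apply: le_trans (ler_wpM2l (expR_ge0 _) HN) _.
rewrite mulr_sumr big_mkcond; apply: ler_sum => X _; case: ifP => // /andP[g1 g2].
have md : Num.min eps d <= d by rewrite ge_min lexx orbT.
by rewrite mulr1; apply: VP; [exact: le_trans g1 md|exact: le_trans g2 md].
Qed.

Lemma card_slot_double n : 2 * #|{: edge_slot n}|%:R <= n%:R ^+ 2 :> R.
Proof.
have := @sum_slot_sym R n (fun _ _ => 1) (fun _ _ => erefl).
rewrite /on_slots !sumr_const card_ord -[1 *+ n *+ n]mulrnA natrM => h.
by rewrite expr2 h lerDr ler0n.
Qed.

Lemma erdos_renyi_lower p n (X : Omega n) : 0 < p < 1 ->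
  expR (n%:R ^+ 2 * (2^-1 * ln (p / (1 - p)) * edge_density (graphon_of X) + 2^-1 * ln (1 - p)))
  <= erdos_renyi p X.
Proof.
move=> /andP[p0 p1]; have p'0 : 0 < 1 - p by rewrite subr_gt0.
have -> : erdos_renyi p X = expR (\sum_(e : edge_slot n) ((X e)%:R * ln (p / (1 - p)) + ln (1 - p))).
  rewrite expR_sum; apply: eq_bigr => e _; case: (X e).
    by rewrite mul1r -lnM ?posrE ?divr_gt0// divfK ?gt_eqF// lnK.
  by rewrite mul0r add0r lnK.
rewrite ler_expR big_split/= -mulr_suml sumr_const mulrDr.
have lep : ln (1 - p) <= 0 by apply: ln_le0; rewrite gerBl ltW.
apply: lerD; last first.
  rewrite -mulr_natl; have := card_slot_double n; nra.
rewrite le_eqVlt; apply/orP; left; apply/eqP.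
rewrite edge_density_graphon_of sum_slot_sym => [|i j]; last by rewrite /adjR adjC.
have -> : \sum_(i < n) adjR X i i = 0 :> R by apply: big1 => i _; rewrite /adjR adjii.
rewrite add0r.
have -> : \sum_(e : edge_slot n) on_slots (adjR X) e = \sum_(e : edge_slot n) (X e)%:R :> R.
  by apply: eq_bigr => e _; rewrite /on_slots /adjR adj_slot.
have [n0|n0] := posnP n; last first.
  have N0 : n%:R != 0 :> R by rewrite pnatr_eq0 -lt0n.
  by field.
have nR0 : n%:R = 0 :> R by rewrite n0.
have -> : \sum_(e : edge_slot n) (X e)%:R = 0 :> R.
  by rewrite big1// => -[[i j] ij] _; exfalso; move: (i); rewrite n0 => -[].
by rewrite nR0 expr0n/= !mul0r.
Qed.

End Laplace.

(** * The partition function and the second moment *)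

Section ImportanceSampling.
Context {R : realType}.
Implicit Types (f g : R -> R -> R) (p q t h beta alpha eps : R).

Lemma gibbs_weight_gt0 h beta alpha n (X : Omega n) : 0 < gibbs_weight h beta alpha X.
Proof. exact: expR_gt0. Qed.

Definition partition_function h beta alpha n : R :=
  \sum_(Y : Omega n) gibbs_weight h beta alpha Y.

Lemma partition_function_gt0 h beta alpha n : 0 < partition_function h beta alpha n.
Proof.
rewrite /partition_function (bigD1 [ffun=> false])//= ltr_pwDl ?gibbs_weight_gt0//.
by apply: sumr_ge0 => Y _; rewrite ltW ?gibbs_weight_gt0.
Qed.

Definition moment_term p t h beta alpha n (X : Omega n) : R :=
  \1_(triangle_upper t) (graphon_of X) * (erdos_renyi p X ^+ 2 / gibbs_weight h beta alpha X).

(** Squaring the likelihood ratio and averaging under the tilt cancels one power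
    of the tilt: its weight ends up in a denominator and its normalization in
    front. *)
Lemma second_moment_gibbs p t h beta alpha n :
  second_moment p t (@gibbs R h beta alpha n) =
  partition_function h beta alpha n * \sum_(X : Omega n) moment_term p t h beta alpha X.
Proof.
rewrite /second_moment /expectation_pmf mulr_sumr; apply: eq_bigr => X _.
have w0 := gibbs_weight_gt0 h beta alpha X; have Z0 := partition_function_gt0 h beta alpha n.
rewrite /moment_term /gibbs -/(partition_function h beta alpha n).
have i2 : (\1_(triangle_upper t) (graphon_of X) : R) ^+ 2 = \1_(triangle_upper t) (graphon_of X).
  by rewrite indicE; case: (_ \in _); rewrite ?expr1n ?expr0n.
rewrite exprMn i2; set c := \1_ _ _; field.
by rewrite !gt_eqF.
Qed.

Lemma gibbs_exponent_lsc h beta alpha eps (E0 T0 : R) :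
  0 <= beta -> 0 <= alpha <= 1 -> 0 <= T0 -> 0 < eps ->
  exists2 d, 0 < d & forall E T, 0 <= T -> `|E - E0| <= d -> `|T - T0| <= d ->
    h / 2 * E0 + beta / 6 * T0 `^ alpha - eps <= h / 2 * E + beta / 6 * T `^ alpha.
Proof.
move=> b0 al01 T00 e0.
have b1 : 0 < beta + 1 by rewrite ltr_wpDl.
have h1 : 0 < `|h| + 1 by rewrite ltr_wpDl.
have [d2 d20 Hd2] := powR_lower al01 T00 (divr_gt0 e0 b1).
pose d1 := eps / (`|h| + 1); have d10 : 0 < d1 by rewrite divr_gt0.
have hd1 : `|h| * d1 <= eps.
  have : d1 * (`|h| + 1) = eps by rewrite /d1 divfK// gt_eqF.
  lra.
have b6 : 0 <= beta / 6 by rewrite divr_ge0.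
have be : beta / 6 * (eps / (beta + 1)) <= eps / 2.
  have q0 : 0 <= eps / (beta + 1) by rewrite divr_ge0 ?ltW.
  have : eps / (beta + 1) * (beta + 1) = eps by rewrite divfK// gt_eqF.
  by move: (eps / (beta + 1)) q0 => z q0; lra.
exists (Num.min d1 d2); first by rewrite lt_min d10.
move=> E T TX0; rewrite !le_min => /andP[Ed _] /andP[_ Td].
have {Hd2 Td} := Hd2 T TX0 Td; move: (T `^ alpha) (T0 `^ alpha) => u v uv.
have {uv} : beta / 6 * (v - eps / (beta + 1)) <= beta / 6 * u by exact: ler_wpM2l.
have : `|h / 2 * (E - E0)| <= eps / 2.
  rewrite normrM normf_div (ger0_norm (ler0n R 2)).
  by have := ler_wpM2l (normr_ge0 h) Ed; move: `|E - E0| => z; lra.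
by rewrite ler_norml; lra.
Qed.

Lemma moment_exponent_lsc (a beta alpha eps E0 T0 : R) :
  0 <= beta -> 0 <= alpha <= 1 -> 0 < T0 -> 0 < eps ->
  exists2 d, 0 < d & forall E T, 0 <= T -> `|E - E0| <= d -> `|T - T0| <= d ->
    a * E0 - beta / 6 * T0 `^ alpha - eps <= a * E - beta / 6 * T `^ alpha.
Proof.
move=> b0 al01 T00 e0; set c := beta / 6 * (T0 `^ alpha / T0); pose K := `|a| + c + 1.
have TT0 : 0 <= T0 `^ alpha / T0 by rewrite divr_ge0 ?powR_ge0// ltW.
have b6 : 0 <= beta / 6 by rewrite divr_ge0.
have c0 : 0 <= c by rewrite mulr_ge0.
have a0 := normr_ge0 a.
have K0 : 0 < K by rewrite /K; lra.
exists (eps / K); first by rewrite divr_gt0.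
move=> E T TX0 Ed Td.
have dK : eps / K * K = eps by rewrite divfK// gt_eqF.
have d0 : 0 < eps / K by rewrite divr_gt0.
move: (eps / K) d0 dK Ed Td => d d0 dK Ed Td.
have hT := le_trans (powR_lip al01 T00 TX0) (ler_wpM2l TT0 Td).
have {}hT : `|beta / 6 * (T `^ alpha - T0 `^ alpha)| <= c * d.
  by rewrite normrM (ger0_norm b6) /c -mulrA; exact: ler_wpM2l.
have hE : `|a * (E - E0)| <= `|a| * d by rewrite normrM; exact: ler_wpM2l.
move: hE hT dK; rewrite /K !(ler_norml (_ * _)); clear K K0.
clearbody c; by move: (T `^ alpha) (T0 `^ alpha) (`|a|) a0 => u v A A0; lra.
Qed.

Lemma partition_function_lower h beta alpha eps g :
  0 <= beta -> 0 <= alpha <= 1 -> kernel g -> 0 < eps ->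
  \forall n \near \oo,
    expR (n%:R ^+ 2 * (h / 2 * edge_density g + beta / 6 * triangle_density g `^ alpha
      - eps - neg_entropy g - eps)) <= partition_function h beta alpha n.
Proof.
move=> b0 al01 kg e0; have /andP[T0 _] := triangle_density01 kg.
have [d d0 Hd] := gibbs_exponent_lsc h (edge_density g) b0 al01 T0 e0.
apply: (@laplace_lower R g (fun n X => gibbs_weight h beta alpha X) _ _ d kg e0 d0) => n X.
  exact: (ltW (gibbs_weight_gt0 _ _ _ _)).
move=> E T; have /andP[TX0 _] := triangle_density01 (@kernel_graphon_of R n X).
rewrite /gibbs_weight ler_expR; apply: ler_wpM2l; first exact: exprn_ge0.
exact: Hd TX0 E T.
Qed.

Lemma ge_of_dist (x y z : R) : `|x - y| <= y - z -> z <= x.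
Proof. by rewrite ler_norml; lra. Qed.

(** The kernel [f] must lie strictly above the threshold: only then do all graphs
    close to it satisfy the triangle constraint. *)
Lemma moment_lower p t h beta alpha eps f :
  0 < p < 1 -> 0 <= beta -> 0 <= alpha <= 1 -> kernel f ->
  0 < triangle_density f -> t ^+ 3 < triangle_density f -> 0 < eps ->
  \forall n \near \oo,
    expR (n%:R ^+ 2 * ((ln (p / (1 - p)) - h / 2) * edge_density f
      - beta / 6 * triangle_density f `^ alpha - eps + ln (1 - p) - neg_entropy f - eps))
    <= \sum_(X : Omega n) moment_term p t h beta alpha X.
Proof.
have close (hp l A u E1 : R) : A <= (hp - h / 2) * E1 - u ->
    A + l + (h / 2 * E1 + u) <= 2 * (2^-1 * hp * E1 + 2^-1 * l) by lra.
move=> p01 b0 al01 kf T0 tT e0; set hp := ln (p / (1 - p)).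
have [d d0 Hd] := moment_exponent_lsc (hp - h / 2) (edge_density f) b0 al01 T0 e0.
pose d' := Num.min d (triangle_density f - t ^+ 3).
have d'0 : 0 < d' by rewrite /d' lt_min subr_gt0 tT d0.
have d'd : d' <= d by rewrite /d' ge_min lexx.
have d'T : d' <= triangle_density f - t ^+ 3 by rewrite /d' ge_min lexx orbT.
apply: (@laplace_lower R f (fun n X => moment_term p t h beta alpha X) _ _ d' kf e0 d'0) => n X.
  apply: mulr_ge0; first by rewrite indicE.
  by apply: divr_ge0; [exact: exprn_even_ge0|exact: (ltW (gibbs_weight_gt0 _ _ _ _))].
move=> E T; have kX := @kernel_graphon_of R n X.
have /andP[TX0 _] := triangle_density01 kX.
have tX : t ^+ 3 <= triangle_density (graphon_of X).
  exact: ge_of_dist (le_trans T d'T).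
have {}Hd := Hd _ _ TX0 (le_trans E d'd) (le_trans T d'd).
rewrite /moment_term indicE mem_set ?mul1r; last by split; first exact: kernel_graphons.
have P1 := erdos_renyi_lower X p01.
have P0 := le_trans (expR_ge0 _) P1.
have P2 : expR (n%:R ^+ 2 * (2^-1 * hp * edge_density (graphon_of X) + 2^-1 * ln (1 - p))) ^+ 2
    <= erdos_renyi p X ^+ 2.
  by rewrite lerXn2r// nnegrE; exact: expR_ge0.
rewrite ler_pdivlMr ?gibbs_weight_gt0//; apply: le_trans P2.
rewrite /gibbs_weight -expRD -expRM_natl ler_expR -mulrDr mulrCA.
apply: ler_wpM2l; first exact: exprn_ge0.
exact: close Hd.
Qed.

End ImportanceSampling.

(** * Near-minimizers of the variational problems *)

Section NearMinimizers.
Context {R : realType}.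
Local Notation I01 := (`[0, 1]%classic : set R).
Implicit Types (f g : R -> R -> R) (p q t u : R).

Lemma phi_le q u f : 0 < q < 1 -> kernel f -> triangle_density f = u ^+ 3 ->
  phi q u <= entropy q f.
Proof.
move=> q01 kf fu; apply: ge_inf; first by exists 0 => _ [g [gg _] <-]; exact: entropy_ge0.
by exists f => //; split => //; exact: kernel_graphons.
Qed.

Lemma eq_entropy r f g : (forall x y, I01 x -> I01 y -> f x y = g x y) -> entropy r f = entropy r g.
Proof. by move=> fg; rewrite !entropyE; apply: eq_avg2 => x y xI yI; rewrite fg. Qed.

Lemma phi_adherent q u (eps : R) : 0 < q < 1 -> 0 <= u <= 1 -> 0 < eps ->
  exists g, [/\ kernel g, triangle_density g = u ^+ 3 & entropy q g < phi q u + eps].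
Proof.
move=> q01 u01 e0.
have hi : has_inf [set entropy q f | f in [set f : R -> R -> R | graphons f /\ triangle_density f = u ^+ 3]].
  split; last by exists 0 => _ [g [gg _] <-]; exact: entropy_ge0.
  exists (entropy q (fun _ _ => u)); exists (fun _ _ => u) => //; split.
    exact/kernel_graphons/kernel_cst.
  exact: triangle_density_cst.
have [_ [f [gf fu] <-] fe] := inf_adherent e0 hi.
have [g kg fg] := graphons_kernel gf; exists g; split; [exact: kg| |].
  by rewrite -fu -(eq_triangle_density fg).
by rewrite -(eq_entropy q fg).
Qed.

Lemma triangle_upper_adherent p t (eps : R) : 0 < p < 1 -> 0 <= t <= 1 -> 0 < eps ->
  exists2 f, kernel f & t ^+ 3 <= triangle_density f /\
    entropy p f < inf [set entropy p f | f in triangle_upper t] + eps.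
Proof.
move=> p01 t01 e0.
have hi : has_inf [set entropy p f | f in triangle_upper t].
  split; last by exists 0 => _ [g [gg _] <-]; exact: entropy_ge0.
  exists (entropy p (fun _ _ => t)); exists (fun _ _ => t) => //; split.
    exact/kernel_graphons/kernel_cst.
  by rewrite triangle_density_cst.
have [_ [f [gf fu] <-] fe] := inf_adherent e0 hi.
have [g kg fg] := graphons_kernel gf; exists g; first exact: kg.
split.
  by rewrite -(eq_triangle_density fg).
by rewrite -(eq_entropy p fg).
Qed.

(** No finite graph has triangle density one, so that for [t = 1] the second
    moment vanishes. *)
Lemma not_optimal_threshold_one p (Q : forall n : nat, Omega n -> R) :
  ~ asymptotically_optimal p 1 Q.
Proof.
rewrite /asymptotically_optimal; set a := _%:E => opt.
have : ((n%:R ^- 2)%:E * lne (second_moment p 1 (@Q n))%:E)%E @[n --> \oo] --> (-oo)%E.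
  apply: cvg_near_cst; exists 1%N => // n /= n0.
  have -> : second_moment p 1 (@Q n) = 0.
    apply: big1 => X _.
    rewrite indicE memNset ?mul0r ?expr0n ?mulr0// => -[_].
    by rewrite expr1n leNgt triangle_density_graphon_of_lt1.
  by rewrite /lne lexx gt0_muleNy// lte_fin invr_gt0 exprn_gt0// ltr0n.
by move=> /(cvg_unique _ opt) => /(_ (@ereal_hausdorff R)).
Qed.

Lemma perturbation_bound (a K eps e E S S1 D c : R) : 0 < e ->
  e * (2 * `|a| + 6 + 3 * K) <= eps -> S1 <= (1 - e) * S + e * c ->
  `|S| <= 3 -> `|c| <= 3 -> `|E| <= 1 -> K * D <= K * (3 * e) ->
  a * E - S - eps <= a * ((1 - e) * E + e * 1) - S1 - K * D.
Proof.
move=> e0 eM S1S S3 c3 E1 KD.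
have aE : `|a * (1 - E)| <= `|a| * 2.
  rewrite normrM ler_wpM2l// (le_trans (ler_normB _ _))// normr1; lra.
have {aE} : e * - (`|a| * 2) <= e * (a * (1 - E)).
  by rewrite (ler_wpM2l (ltW e0))//; move: aE; rewrite ler_norml => /andP[].
have : e * (- 6) <= e * (S - c).
  by rewrite (ler_wpM2l (ltW e0))//; move: S3 c3; rewrite !ler_norml; lra.
move: `|a| eM => A eM; lra.
Qed.

(** Mixing in a little of the constant kernel [1] raises the triangle density
    strictly while moving everything else by an arbitrarily small amount. *)
Lemma raise_triangles f (a K eps : R) : kernel f -> triangle_density f < 1 -> 0 < eps ->
  0 <= K ->
  exists f1, [/\ kernel f1, triangle_density f < triangle_density f1 &
    a * edge_density f - neg_entropy f - eps
      <= a * edge_density f1 - neg_entropy f1 - K * (triangle_density f1 - triangle_density f)].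
Proof.
move=> kf T1 e0 K0.
have one01 : 0 <= (1 : R) <= 1 by apply/andP; split; [exact: ler01|exact: lexx].
have zero01 : 0 <= (0 : R) <= 1 by apply/andP; split; [exact: lexx|exact: ler01].
pose M := 2 * `|a| + 6 + 3 * K; have M0 : 0 < M by rewrite /M ltr_wpDr ?ltr_wpDl ?mulr_ge0.
pose e := Num.min 1 (eps / M); have e1 : e <= 1 by rewrite /e ge_min lexx.
have e00 : 0 < e by rewrite /e lt_min ltr01; exact: divr_gt0.
have eM : e * M <= eps by rewrite -ler_pdivlMr// /e ge_min lexx orbT.
have e01 : 0 <= e <= 1 by rewrite (ltW e00) e1.
have [bf f01 _] := kf.
exists (mix f 1 e); split; first exact: kernel_mix.
  apply: lt_le_trans (triangle_density_mix_one kf e01).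
  by rewrite ltrDl mulr_gt0 ?exprn_gt0// subr_gt0.
have hT := triangle_density_mix_dist kf one01 e01 zero01.
rewrite mix0 subr0 (gtr0_norm e00) in hT.
have {}hT := ler_wpM2l K0 (le_trans (ler_norm _) hT).
rewrite edge_density_mix//.
have hs : `|neg_entropy f| <= 3.
  rewrite (le_trans (le_norm_avg2 (bmeas2_neg_entropy_fun kf)))// -[leRHS](avg2_cst (R := R)).
  apply: le_avg2 => [||x y _ _]; [exact: bmeas2_norm (bmeas2_neg_entropy_fun kf)|exact: bmeas2_cst|].
  exact: neg_entropy_fun_bound.
have hE : `|edge_density f| <= 1.
  rewrite edge_densityE; apply: le_trans (le_norm_avg2 bf) _; rewrite -[leRHS](avg2_cst (R := R)).
  apply: le_avg2 => [||x y _ _]; [exact: bmeas2_norm bf|exact: bmeas2_cst|].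
  by have /andP[f0 f1] := f01 x y; rewrite ger0_norm.
exact: perturbation_bound e00 eM (neg_entropy_mix kf one01 e01) hs (neg_entropy_fun_bound one01) hE hT.
Qed.

End NearMinimizers.

(** * The second moment is exponentially too large *)

Section Separation.
Context {R : realType}.

(** The bookkeeping of the proof.  [S] and [E] stand for the negative entropies
    and edge densities of three kernels: [f0], a near-minimizer at the threshold;
    [f1], a perturbation of [f0] strictly above it; and [g], which beats the
    threshold in the variational problem for the partition function.  The
    advantage [16 gam] of [g] pays for eight errors of size [gam]. *)
Lemma exponent_gap (a h hp lp lq J b T0a T1a Tga S0 E0 S1 E1 Sg Eg D phit phiu gam : R) :
  a = hp - h / 2 ->
  S0 - 2^-1 * hp * E0 - 2^-1 * lp < J + gam ->
  phit <= S0 - 2^-1 * h * E0 - 2^-1 * lq ->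
  Sg - 2^-1 * h * Eg - 2^-1 * lq < phiu + gam ->
  a * E0 - S0 - gam <= a * E1 - S1 - D -> b * (T1a - T0a) <= D ->
  b * Tga - phiu - (b * T0a - phit) = 16 * gam ->
  - 2 * J + 8 * gam <= (h / 2 * Eg + b * Tga - gam - Sg - gam)
    + (a * E1 - b * T1a - gam + lp - S1 - gam).
Proof. by move=> ->; lra. Qed.

Lemma gap_absurd (J gam : R) : 0 < gam -> - 2 * J + 8 * gam <= - 2 * J -> False.
Proof. lra. Qed.

Lemma powR_cube (t alpha : R) : 0 <= t -> (t ^+ 3) `^ alpha = t `^ (3 * alpha).
Proof. by move=> t0; rewrite powRrM powR_mulrn. Qed.

Lemma second_moment_rate (p t h beta alpha c : R) (n : nat) : (0 < n)%N ->
  expR (n%:R ^+ 2 * c) <= second_moment p t (@gibbs R h beta alpha n) ->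
  (c%:E <= (n%:R ^- 2)%:E * lne (second_moment p t (@gibbs R h beta alpha n))%:E)%E.
Proof.
move=> n0; move: (second_moment _ _ _) => M cM.
have N0 : 0 < n%:R ^+ 2 :> R by rewrite exprn_gt0// ltr0n.
have M0 : 0 < M by exact: lt_le_trans (expR_gt0 _) cM.
rewrite lne_EFin// -EFinM lee_fin ler_pdivlMl//.
by rewrite -ler_expR lnK// posrE.
Qed.

End Separation.

Theorem proposition3p1 (R : realType) (p t h beta alpha q : R)
  (hp : 0 < p < 1) (hpt : p < t) (ht1 : t <= 1)
  (hbeta : 0 <= beta) (halpha : 0 <= alpha <= 1)
  (hq : 0 < q < 1) (hh : h = ln (q / (1 - q)))
  (hsup : sup [set beta / 6 * u `^ (3 * alpha) - phi q u - 2^-1 * ln (1 - q)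
                 | u in `[0, 1]%classic]
          <> beta / 6 * t `^ (3 * alpha) - phi q t - 2^-1 * ln (1 - q)) :
  ~ asymptotically_optimal p t (gibbs h beta alpha).
Proof.
have p0 : 0 < p by case/andP: hp.
have t0 : 0 < t by exact: lt_trans hpt.
have [->|t1] := eqVneq t 1; first exact: not_optimal_threshold_one.
have {}t1 : t < 1 by rewrite lt_neqAle t1.
have t01 : 0 <= t <= 1 by rewrite ltW.
pose val u := beta / 6 * u `^ (3 * alpha) - phi q u - 2^-1 * ln (1 - q).
have [u u01 vu] : exists2 u, 0 <= u <= 1 & val t < val u.
  apply: contrapT => nu; apply: hsup; rewrite -/(val t).
  have vt u : 0 <= u <= 1 -> val u <= val t.
    by move=> u01; rewrite leNgt; apply/negP => vu; apply: nu; exists u.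
  have tS : [set val u | u in `[0, 1]%classic] (val t) by exists t => //=; rewrite in_itv.
  have ubS : ubound [set val u | u in `[0, 1]%classic] (val t).
    by move=> _ [u uI <-]; apply: vt; move: uI; rewrite /= in_itv.
  apply: le_anti; apply/andP; split; first by apply: ge_sup => //; exists (val t).
  by apply: ub_le_sup => //; exists (val t).
(* [exponent_gap] loses [gam] eight times, and half of the gap must survive. *)
pose gam := (val u - val t) / 16.
have gam0 : 0 < gam by rewrite divr_gt0// subr_gt0.
have [g [kg Tg gphi]] := phi_adherent hq u01 gam0.
have [f kf [tf fJ]] := triangle_upper_adherent hp t01 gam0.
have [f0 [kf0 Tf0 f0f]] := entropy_at_threshold hp hpt kf tf.
have T00 : 0 < triangle_density f0 by rewrite Tf0 exprn_gt0.
have T01 : triangle_density f0 < 1 by rewrite Tf0 exprn_ilt1// ltW.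
have b6 : 0 <= beta / 6 by rewrite divr_ge0.
pose K := triangle_density f0 `^ alpha / triangle_density f0.
have K0 : 0 <= beta / 6 * K by exact: mulr_ge0 b6 (divr_ge0 (powR_ge0 _ _) (ltW T00)).
have [f1 [kf1 Tf1 f1E]] := raise_triangles (ln (p / (1 - p)) - h / 2) kf0 T01 gam0 K0.
have T10 : 0 < triangle_density f1 by exact: lt_trans Tf1.
have Kb : beta / 6 * (triangle_density f1 `^ alpha - triangle_density f0 `^ alpha)
    <= beta / 6 * K * (triangle_density f1 - triangle_density f0).
  rewrite -[leRHS]mulrA; apply: (ler_wpM2l b6); apply: (le_trans (ler_norm _)).
  have d0 : 0 <= triangle_density f1 - triangle_density f0 by rewrite subr_ge0; exact: ltW.
  rewrite -(ger0_norm d0); exact: powR_lip halpha T00 (ltW T10).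
have Z := partition_function_lower h hbeta halpha kg gam0.
have tf1 : t ^+ 3 < triangle_density f1 by rewrite -Tf0.
have M := moment_lower h hp hbeta halpha kf1 T10 tf1 gam0.
set J := inf _ in fJ.
pose c : R := - 2 * J + 8 * gam.
suff LB : \forall n \near \oo,
    (c%:E <= (n%:R ^- 2)%:E * lne (second_moment p t (@gibbs R h beta alpha n))%:E)%E.
  move=> opt; have /(_ _) := cvge_ge LB opt; rewrite -/J lee_fin /c.
  exact: gap_absurd gam0.
have [N _ HN] := filterI (nbhs_infty_gt 0%N) (filterI Z M).
exists N => // n /HN /= [n0 [Zn Mn]].
apply: second_moment_rate => //; rewrite second_moment_gibbs.
apply: le_trans (ler_pM (expR_ge0 _) (expR_ge0 _) Zn Mn).
rewrite -expRD -mulrDr ler_expR; apply: ler_wpM2l; first exact: exprn_ge0.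
have e1 : neg_entropy f0 - 2^-1 * ln (p / (1 - p)) * edge_density f0 - 2^-1 * ln (1 - p) < J + gam.
  by rewrite -(entropy_neg_entropy hp kf0); exact: le_lt_trans f0f fJ.
have e2 : phi q t <= neg_entropy f0 - 2^-1 * h * edge_density f0 - 2^-1 * ln (1 - q).
  by rewrite hh -(entropy_neg_entropy hq kf0); exact: phi_le.
have e3 : neg_entropy g - 2^-1 * h * edge_density g - 2^-1 * ln (1 - q) < phi q u + gam.
  by rewrite hh -(entropy_neg_entropy hq kg); exact: gphi.
have e4 : beta / 6 * triangle_density g `^ alpha - phi q u
    - (beta / 6 * triangle_density f0 `^ alpha - phi q t) = 16 * gam.
  have /andP[u0 _] := u01; rewrite Tf0 Tg !powR_cube// ?(ltW t0)//.
  by rewrite /gam /val; field.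
exact: exponent_gap erefl e1 e2 e3 f1E Kb e4.
Qed.
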